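(* Let $X$ be a Banach space. If the Banach space $C(\beta\mathbb N\times[1,\omega],X)$ contains a complemented subspace isomorphic to $C([1,\omega^\omega])$, then $X$ contains a subspace isomorphic to $c_0$.
   Context: For a compact Hausdorff space $K$ and a Banach space $X$, $C(K,X)$ is the Banach space of continuous functions $f:K\to X$ with norm $\|f\|=\sup_{k\in K}\|f(k)\|_X$; $C(K)=C(K,\mathbb R)$. $\beta\mathbb N$ is the Stone–Čech compactification of the discrete space $\mathbb N$. For an ordinal $\alpha$, $[1,\alpha]$ is the compact space of ordinals between $1$ and $\alpha$ in the order topology; powers of ordinals are ordinal powers. ''Isomorphic'' means linearly homeomorphic. *)

(* Defs.v *)
From HB Require Import structures.
From mathcomp Require Import all_boot all_order all_algebra finmap.
From mathcomp Require Import all_classical all_reals all_analysis.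

Set Implicit Arguments.
Unset Strict Implicit.
Unset Printing Implicit Defensive.

Import Order.TTheory GRing.Theory Num.Theory.
Import numFieldNormedType.Exports.

Local Open Scope classical_set_scope.
Local Open Scope ring_scope.

HB.mixin Record isCompactHausdorff T & Topological T := {
  compactT : compact [set: T];
  hausdorffT : hausdorff_space T
}.

#[short(type="compactHausdorffType")]
HB.structure Definition CompactHausdorff :=
  {T of Topological T & isCompactHausdorff T}.

Section prod_compact_hausdorff.
Context (K L : compactHausdorffType).

Let prod_compact : compact [set: K * L].
Proof. by rewrite -setXTT; apply: compact_setX; exact: compactT. Qed.

Let prod_hausdorff : hausdorff_space (K * L)%type.
Proof.
move=> [x1 x2] [y1 y2] xy; congr pair; apply: hausdorffT => A B nA nB.
  have [||[z1 z2] [[/= Az _] [Bz _]]] := xy (A `*` setT) (B `*` setT).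
  - by exists (A, setT) => //=; split => //; exact: filterT.
  - by exists (B, setT) => //=; split => //; exact: filterT.
  - by exists z1.
have [||[z1 z2] [[/= _ Az] [_ Bz]]] := xy (setT `*` A) (setT `*` B).
- by exists (setT, A) => //=; split => //; exact: filterT.
- by exists (setT, B) => //=; split => //; exact: filterT.
- by exists z2.
Qed.

HB.instance Definition _ :=
  isCompactHausdorff.Build (K * L)%type prod_compact prod_hausdorff.

End prod_compact_hausdorff.

(* A nonzero ordinal is represented by a well-ordered type with a least element
   whose order type it is; omega is represented by nat. *)
HB.mixin Record isWellOrder d T & Order.BTotal d T := {
  well_ordered : forall S : set T, S !=set0 ->
    exists2 x, S x & forall y, S y -> (x <= y)%O
}.

#[short(type="wellOrderType")]
HB.structure Definition WellOrder d :=
  {T of Order.BTotal d T & isWellOrder d T}.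

Section nat_well_order.

Let nat_well_ordered (S : set nat) : S !=set0 ->
  exists2 x, S x & forall y, S y -> (x <= y)%O.
Proof.
move=> [n Sn]; have exS : exists n, `[< S n >] by exists n; exact/asboolP.
exists (ex_minn exS); first by case: ex_minnP => m /asboolP.
by move=> y /asboolP Sy; case: ex_minnP => m _ /(_ _ Sy).
Qed.

HB.instance Definition _ := isWellOrder.Build _ nat nat_well_ordered.

End nat_well_order.

Lemma well_order_ind d (A : wellOrderType d) (P : A -> Prop) :
  (forall x, (forall y, (y < x)%O -> P y) -> P x) -> forall x, P x.
Proof.
move=> IH x; apply: contrapT => nPx.
have [|y nPy ymin] := @well_ordered _ A (~` P); first by exists x.
apply: nPy; apply: IH => z zy; apply: contrapT => /ymin.
by rewrite leNgt zy.
Qed.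

Fact ordpow_display : Order.disp_t. Proof. exact: Order.Disp tt tt. Qed.

(* The ordinal power A ^ B: finitely supported functions from B to A, compared
   at the largest argument where they differ. *)
Record ordpow dA (A : wellOrderType dA) dB (B : wellOrderType dB) :=
  OrdPow { ordpow_fun :> {fsfun B -> A with (\bot : A)%O} }.

Section ordpow.
Context {dA} (A : wellOrderType dA) {dB} (B : wellOrderType dB).
Local Notation T := (ordpow A B).

HB.instance Definition _ := [isNew for @ordpow_fun dA A dB B].
HB.instance Definition _ := [Choice of T by <:].

Definition ordpow_lt (f g : T) : bool :=
  `[< exists2 b, (f b < g b)%O & forall c, (b < c)%O -> f c = g c >].

Let pow_irr : irreflexive ordpow_lt.
Proof. by move=> f; apply/asboolP => -[b]; rewrite ltxx. Qed.

Let pow_trans : transitive ordpow_lt.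
Proof.
move=> g f h /asboolP[b fg efg] /asboolP[c gh egh]; apply/asboolP.
have [bc|cb|bc] := ltgtP b c.
- exists c; first by rewrite efg.
  by move=> e ce; rewrite efg ?egh// (lt_trans bc).
- exists b; first by rewrite -egh.
  by move=> e be; rewrite efg ?egh// (lt_trans cb).
- exists b; first by rewrite (lt_trans fg)// bc.
  by move=> e be; rewrite efg ?egh// -bc.
Qed.

HB.instance Definition _ :=
  Order.Lt_isPOrder.Build ordpow_display T pow_irr pow_trans.

Lemma ordpow_ltP (f g : T) : reflect
  (exists2 b, (f b < g b)%O & forall c, (b < c)%O -> f c = g c) (f < g)%O.
Proof. exact: asboolP. Qed.

Lemma ordpowP (f g : T) : f =1 g -> f = g.
Proof. by move=> fg; apply: val_inj; apply/fsfunP. Qed.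

Let fin_max (s : seq B) : s != [::] ->
  exists2 b, b \in s & forall c, c \in s -> (c <= b)%O.
Proof.
elim: s => // x s IH _; have [->|s0] := eqVneq s [::].
  by exists x => [|c]; rewrite mem_seq1// => /eqP->.
have [b bs hb] := IH s0; have [xb|bx] := leP x b.
  by exists b => [|c]; rewrite inE ?bs ?orbT// => /predU1P[->//|/hb].
exists x => [|c]; rewrite inE ?eqxx// => /predU1P[->//|/hb cb].
by rewrite (le_trans cb)// ltW.
Qed.

Let diff_max (f g : T) : f <> g ->
  exists2 b, f b != g b & forall c, (b < c)%O -> f c = g c.
Proof.
move=> fg.
pose s := [seq b <- finsupp (ordpow_fun f) ++ finsupp (ordpow_fun g) | f b != g b].
have sP b : f b != g b -> b \in s.
  move=> fgb; rewrite mem_filter fgb/= mem_cat.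
  case: finsuppP fgb => //= fb.
  by case: finsuppP => //; rewrite eqxx.
have [|b bs hb] := @fin_max s.
  apply/eqP => s0; apply: fg; apply: ordpowP => b; apply/eqP/negPn/negP.
  by move/sP; rewrite s0.
exists b; first by move: bs; rewrite mem_filter => /andP[].
move=> c bc; apply/eqP/negPn/negP => /sP/hb.
by rewrite leNgt bc.
Qed.

Let pow_total : total (<=%O : rel T).
Proof.
move=> f g; have [->|/eqP] := eqVneq f g; first by rewrite lexx.
move=> /diff_max[b]; rewrite neq_lt => /orP[] fgb h; apply/orP.
- by left; apply/ltW/ordpow_ltP; exists b.
- by right; apply/ltW/ordpow_ltP; exists b => // c /h.
Qed.

HB.instance Definition _ := Order.POrder_isTotal.Build ordpow_display T pow_total.

Let ordpow0 : T := OrdPow [fsfun with (\bot : A)%O].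

Let ordpow0_le (f : T) : (ordpow0 <= f)%O.
Proof.
rewrite leNgt; apply/negP => /ordpow_ltP[b].
by rewrite fsfunE ltx0.
Qed.

HB.instance Definition _ := Order.hasBottom.Build ordpow_display T ordpow0_le.

Let ordpow0E b : (\bot%O : T) b = \bot%O.
Proof. exact: fsfun0E. Qed.

Let upd (f : T) (d : B) : T := OrdPow
  [fsfun x in finsupp (ordpow_fun f) => if x == d then \bot%O else f x | \bot%O].

Let updE f d x : upd f d x = if x == d then \bot%O else f x.
Proof.
rewrite /upd /= fsfun_fun; case: ifPn => // xf.
by case: ifPn => // _; rewrite fsfun_dflt.
Qed.

Let has_min (S : set T) := exists2 f, S f & forall g, S g -> (f <= g)%O.

Let lead (f : T) d := f d != \bot%O /\ forall e, (d < e)%O -> f e = \bot%O.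

Let P c := forall S : set T, S !=set0 ->
  (forall f d, S f -> (c <= d)%O -> f d = \bot%O) -> has_min S.

Let P_step (S : set T) : S !=set0 ->
  (forall f d, S f -> f d != \bot%O -> P d) -> has_min S.
Proof.
move=> [h Sh] PS; have [S0|nS0] := pselect (S \bot%O).
  by exists \bot%O => // g _; exact: le0x.
have leadS f : S f -> exists d, lead f d.
  move=> Sf; have [|b fb bf] := @diff_max f \bot%O; first by move=> f0; rewrite -f0 in nS0.
  exists b; split; first by rewrite ordpow0E in fb.
  by move=> e /bf; rewrite ordpow0E.
have [|d [f1 [Sf1 f1d]] dmin] := @well_ordered _ B [set d | exists f, S f /\ lead f d].
  by have [d hd] := leadS _ Sh; exists d, h.
have [|a [f2 [Sf2 [f2d f2a]]] amin] :=
    @well_ordered _ A [set a | exists f, S f /\ lead f d /\ f d = a].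
  by exists (f1 d), f1.
pose S' := [set g | exists f, [/\ S f, lead f d, f d = a & g = upd f d]].
have [||g [f [Sf [fd fd0] fa ->]] fmin] := PS _ _ Sf1 f1d.1 S'.
- by exists (upd f2 d), f2.
- move=> _ e [f [_ [_ fd0] _ ->]] de; rewrite updE.
  by case: eqVneq => // ed; rewrite fd0// lt_neqAle eq_sym ed.
- exists f => // k Sk; have [e ke] := leadS _ Sk.
  have : (d <= e)%O by apply: dmin; exists k.
  rewrite le_eqVlt => /predU1P[de|de]; last first.
    apply/ltW/ordpow_ltP; exists e => [|c ec]; first by rewrite fd0// lt0x ke.1.
    by rewrite fd0 ?ke.2// (lt_trans de).
  rewrite -{e}de in ke.
  have : (a <= k d)%O by apply: amin; exists k.
  rewrite le_eqVlt => /predU1P[ak|ak]; last first.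
    apply/ltW/ordpow_ltP; exists d => [|c dc]; first by rewrite fa.
    by rewrite fd0 ?ke.2.
  rewrite leNgt; apply/negP => /ordpow_ltP[b kf kfE].
  have bd : b != d by apply/eqP => bd; rewrite bd fa -ak ltxx in kf.
  have : (upd f d <= upd k d)%O by apply: fmin; exists k.
  rewrite leNgt => /negP; apply; apply/ordpow_ltP; exists b.
    by rewrite !updE (negbTE bd).
  by move=> c bc; rewrite !updE kfE.
Qed.

Let P_all c : P c.
Proof.
elim/well_order_ind: c => c IH S S0 Sc; apply: P_step => // f d Sf fd.
apply: IH; rewrite ltNge; apply: contra fd => cd.
by rewrite (Sc f).
Qed.

Let ordpow_well_ordered (S : set T) : S !=set0 -> has_min S.
Proof. by move=> S0; apply: P_step => // *; exact: P_all. Qed.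

HB.instance Definition _ := isWellOrder.Build _ T ordpow_well_ordered.

End ordpow.

(* The ordinal interval [1, alpha] for alpha the order type of A: the nonzero
   ordinals below alpha are the x : A distinct from the least element of A, and
   the additional top element is alpha itself. *)
Variant ord_itv1 dA (A : wellOrderType dA) :=
  | ItvBelow (x : A) of x != \bot%O
  | ItvTop.
Arguments ItvTop {dA A}.

Fact ord_itv1_display : Order.disp_t. Proof. exact: Order.Disp tt tt. Qed.

Section ord_itv1.
Context {dA} (A : wellOrderType dA).
Local Notation T := (ord_itv1 A).

HB.instance Definition _ := gen_eqMixin T.
HB.instance Definition _ := gen_choiceMixin T.

Definition ord_itv1_le (x y : T) : bool :=
  match x, y with
  | ItvBelow a _, ItvBelow b _ => (a <= b)%O
  | _, ItvTop => true
  | ItvTop, ItvBelow _ _ => false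
  end.

Let itv1_le_refl : reflexive ord_itv1_le.
Proof. by case=> //= a _; exact: lexx. Qed.

Let itv1_le_anti : antisymmetric ord_itv1_le.
Proof.
move=> [a a0|] [b b0|] //= /le_anti ab; case: _ / ab in b0 *.
by congr ItvBelow; exact: bool_irrelevance.
Qed.

Let itv1_le_trans : transitive ord_itv1_le.
Proof. by move=> [b b0|] [a a0|] [c c0|] //=; exact: le_trans. Qed.

HB.instance Definition _ :=
  Order.Le_isPOrder.Build ord_itv1_display T itv1_le_refl itv1_le_anti itv1_le_trans.

Let itv1_le_total : total (<=%O : rel T).
Proof. by move=> [a a0|] [b b0|] //; exact: le_total. Qed.

HB.instance Definition _ :=
  Order.POrder_isTotal.Build ord_itv1_display T itv1_le_total.

HB.instance Definition _ := OrderTopological.copy T (order_topology T).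

Let itv1_top (x : T) : (x <= ItvTop)%O.
Proof. by case: x. Qed.

Let itv1_min (S : set T) : S !=set0 ->
  exists2 x, S x & forall y, S y -> (x <= y)%O.
Proof.
move=> S0.
have [[a0 [h0 Sa0]]|nS] := pselect (exists a (h : a != \bot%O), S (@ItvBelow _ A a h)).
  have [|a [h Sa] amin] :=
      @well_ordered _ A [set a | exists h : a != \bot%O, S (ItvBelow h)].
    by exists a0, h0.
  exists (ItvBelow h) => // -[b b0|//] Sb.
  by apply: amin; exists b0.
have Stop x : S x -> x = ItvTop.
  by case: x => // a h Sa; exfalso; apply: nS; exists a, h.
by case: S0 => x Sx; exists x => // y /Stop ->.
Qed.

Let itv1_compact : compact [set: T].
Proof.
move=> F FF _.
have [|x Fx xmin] := itv1_min (S := [set x | F [set y | (y <= x)%O]]).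
  by exists ItvTop => /=; apply: filterS filterT => y _; exact: itv1_top.
exists x; split=> // U V FU.
rewrite (@itv_nbhsE _ T) => -[[l r] [] oi xi iV].
case: (l) xi oi iV => [b y|b].
  rewrite itv_boundlr => /andP[yx xr] oi iV.
  have b0 : b = false by case: (b) oi => //; case: (r) => [[]|[]].
  have {}yx : (y < x)%O by move: yx; rewrite b0 bnd_simp.
  apply: contrapT => UV0.
  suff : (x <= y)%O by rewrite leNgt yx.
  apply: xmin => /=; apply: filterS (filterI FU Fx) => z [Uz zx] /=.
  rewrite leNgt; apply/negP => yz; apply: UV0; exists z; split=> //; apply: iV.
  rewrite /= itv_boundlr b0 bnd_simp yz/=.
  by apply: Order.POrderTheory.le_trans xr; rewrite bnd_simp.
rewrite itv_boundlr => /andP[yx xr] oi iV.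
have [z [Uz zx]] := filter_ex (filterI FU Fx).
exists z; split=> //; apply: iV; rewrite /= itv_boundlr.
apply/andP; split; first by case: (b) yx => //; rewrite bnd_simp.
by apply: Order.POrderTheory.le_trans xr; rewrite bnd_simp.
Qed.

HB.instance Definition _ :=
  isCompactHausdorff.Build T itv1_compact order_hausdorff.

End ord_itv1.

(* The Stone-Cech compactification of the discrete space T, realized as the
   Stone space of ultrafilters on T; stone_cech_dense and stone_cech_extension
   below are its universal property. *)
Record stone_cech (T : Type) := StoneCech {
  stone_cech_filter :> set T -> Prop;
  stone_cech_ultra : UltraFilter stone_cech_filter
}.

Lemma ultraFilterP T (F : set_system T) : ProperFilter F ->
  (forall A, F A \/ F (~` A)) -> UltraFilter F.
Proof.
move=> FF FV; split=> // G GG FG; apply/seteqP; split=> // A GA.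
have [//|/FG GnA] := FV A.
by have /filter_ex[x []] : G (A `&` ~` A) by exact: filterI.
Qed.

Section stone_cech.
Context (T : Type).
Local Notation bT := (stone_cech T).

Local Instance stone_cech_ultra_inst (u : bT) : UltraFilter u :=
  stone_cech_ultra u.

HB.instance Definition _ := gen_eqMixin bT.
HB.instance Definition _ := gen_choiceMixin bT.

Definition stone_cech_basic (A : set T) : set bT := [set u : bT | u A].

Let basic_cover : \bigcup_(A in setT) stone_cech_basic A = setT.
Proof.
by apply/seteqP; split=> // u _; exists setT => //; exact: (@filterT _ u).
Qed.

Let basic_join (A B : set T) (u : bT) : setT A -> setT B ->
  stone_cech_basic A u -> stone_cech_basic B u ->
  exists C, [/\ setT C, stone_cech_basic C u &
    stone_cech_basic C `<=` stone_cech_basic A `&` stone_cech_basic B].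
Proof.
move=> _ _ uA uB; exists (A `&` B); split=> //.
  exact: (@filterI _ u _ A B uA uB).
move=> v vAB; split.
- exact: (@filterS _ v _ (A `&` B) A (@subIsetl _ A B) vAB).
- exact: (@filterS _ v _ (A `&` B) B (@subIsetr _ A B) vAB).
Qed.

HB.instance Definition _ :=
  isBaseTopological.Build bT basic_cover basic_join.

Lemma stone_cech_basic_open A : open (stone_cech_basic A).
Proof. by exists [set A] => //; rewrite bigcup_set1. Qed.

Lemma stone_cech_nbhsP (u : bT) (U : set bT) :
  nbhs u U <-> exists2 A, u A & stone_cech_basic A `<=` U.
Proof.
rewrite nbhsE; split=> [[V [[D _ <-] [A DA uA]] VU]|[A uA AU]].
  by exists A => // v vA; apply: VU; exists A.
by exists (stone_cech_basic A) => //; split=> //; exact: stone_cech_basic_open.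
Qed.

Let stone_cech_compact : compact [set: bT].
Proof.
rewrite compact_ultra => F FU _.
pose u := [set A | F (stone_cech_basic A)].
have uF : ProperFilter u.
  apply: Build_ProperFilter_ex.
    move=> A FA; have [v vA] := @filter_ex _ F _ _ FA; exact: (@filter_ex _ v _ A vA).
  split; rewrite /u /=.
  - by apply: (@filterS _ F) filterT => v _; exact: (@filterT _ v).
  - move=> A B FA FB; apply: (@filterS _ F) (@filterI _ F _ _ _ FA FB) => v [vA vB].
    exact: (@filterI _ v _ A B vA vB).
  - move=> A B AB; apply: (@filterS _ F) => v vA.
    exact: (@filterS _ v _ A B AB vA).
have uU : UltraFilter u.
  apply: ultraFilterP => A; rewrite /u /=.
  have [FA|FA] := in_ultra_setVsetC (stone_cech_basic A) FU; first by left.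
  right; apply: (@filterS _ F) FA => v vA.
  by have [] := in_ultra_setVsetC A (stone_cech_ultra v).
exists (StoneCech uU); split=> // U /stone_cech_nbhsP[A uA AU].
exact: (@filterS _ F _ _ _ AU uA).
Qed.

Let stone_cech_hausdorff : hausdorff_space bT.
Proof.
move=> u v uv; apply: contrapT => neq.
have uvA A : u A -> v A.
  move=> uA; have [//|vA] := in_ultra_setVsetC A (stone_cech_ultra v).
  have [||w [/= wA wnA]] := uv (stone_cech_basic A) (stone_cech_basic (~` A)).
  - by apply/stone_cech_nbhsP; exists A.
  - by apply/stone_cech_nbhsP; exists (~` A).
  - have [x []] := @filter_ex _ w _ _ (@filterI _ w _ _ _ wA wnA).
    by [].
have := @max_filter _ u (stone_cech_ultra u) v _ uvA.
case: u v {uvA uv} neq => [u uU] [v vU] /= neq vu; apply: neq.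
by case: _ / vu in uU *; congr StoneCech; exact: Prop_irrelevance.
Qed.

HB.instance Definition _ :=
  isCompactHausdorff.Build bT stone_cech_compact stone_cech_hausdorff.

Definition stone_cech_in (x : T) : bT :=
  StoneCech (principal_filter_ultra x).

Lemma stone_cech_dense : closure (range stone_cech_in) = setT.
Proof.
apply/seteqP; split=> // u _ U /stone_cech_nbhsP[A uA AU].
have [x Ax] := @filter_ex _ u _ A uA.
exists (stone_cech_in x); split; first by exists x.
by apply: AU; exact/principal_filterP.
Qed.

Lemma stone_cech_extension (K : compactHausdorffType) (f : T -> K) :
  exists! g : bT -> K, continuous g /\ g \o stone_cech_in = f.
Proof.
have fultra (u : bT) : UltraFilter (fmap f u).
  apply: ultraFilterP => A; exact: in_ultra_setVsetC (f @^-1` A) _.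
have flim (u : bT) : {x : K | fmap f u --> x}.
  apply: cid; have := @compactT K; rewrite compact_ultra => /(_ (fmap f u) _).
  by case=> [|x [_ xu]]; [exact: filterT|exists x].
pose g u := projT1 (flim u).
have gP (u : bT) : fmap f u --> g u by exact: projT2 (flim u).
have gc : continuous g.
  move=> u V gV.
  have [W gW WV] := @compact_regular K (g u) _ (@hausdorffT K) (@compactT K)
    (@filterT _ (nbhs (g u)) _) V gV.
  apply/stone_cech_nbhsP; exists (f @^-1` W); first exact: gP.
  move=> v vW; apply: WV => Z gZ.
  have /= vZ := gP v _ gZ.
  by have [x [? ?]] := @filter_ex _ v _ _ (@filterI _ v _ _ _ vW vZ); exists (f x).
exists g; split.
  split=> //; apply/funext => x /=; apply/esym; apply: hausdorffT.
  move=> A B fA gB; exists (f x); split; first exact: nbhs_singleton.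
  by have /principal_filterP := gP (stone_cech_in x) _ gB.
move=> h [hc hf]; apply/funext => u; apply: hausdorffT => A B gA hB.
have nA : nbhs u (g @^-1` A) by exact: gc.
have nB : nbhs u (h @^-1` B) by exact: hc.
have : closure (range stone_cech_in) u by rewrite stone_cech_dense.
move=> /(_ _ (filterI nA nB)) [_ [[x _ <-] [gx hx]]].
exists (f x); split; last by rewrite -hf.
suff -> : f x = g (stone_cech_in x) by [].
apply: hausdorffT.
move=> C D fC gD; exists (f x); split; first exact: nbhs_singleton.
by have /principal_filterP := gP (stone_cech_in x) _ gD.
Qed.

End stone_cech.

Section sup_norm.
Context {R : realType} {T : Type} {X : normedModType R}.
Implicit Types f g : T -> X.

Definition sup_norm f : R := sup (range (fun t => `|f t|)).

Definition bounded_map f := has_ubound (range (fun t => `|f t|)).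

Lemma sup_norm_ub f t : bounded_map f -> `|f t| <= sup_norm f.
Proof. by move=> fb; apply: ub_le_sup => //; exists t. Qed.

Lemma sup_norm_le f M : 0 <= M -> (forall t, `|f t| <= M) -> sup_norm f <= M.
Proof.
move=> M0 fM; rewrite /sup_norm.
have [->|r0] := eqVneq (range (fun t => `|f t|)) set0; first by rewrite sup0.
by apply: ge_sup; [exact/set0P|move=> _ [t _ <-]].
Qed.

Lemma sup_norm_ge0 f : bounded_map f -> 0 <= sup_norm f.
Proof.
move=> fb; have [[t]|nT] := pselect (inhabited T).
  exact: le_trans (sup_norm_ub t fb).
rewrite /sup_norm (_ : [set _ | _ in _] = set0) ?sup0//.
by rewrite -subset0 => r [t rt]; apply: False_ind; exact: (nT (inhabits t)).
Qed.

Lemma sup_norm_leP f M : bounded_map f -> 0 <= M ->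
  sup_norm f <= M <-> forall t, `|f t| <= M.
Proof.
move=> fb M0; split=> [fM t|]; last exact: sup_norm_le.
exact: le_trans (sup_norm_ub t fb) fM.
Qed.

Lemma sup_normD f g : bounded_map f -> bounded_map g ->
  sup_norm (f + g) <= sup_norm f + sup_norm g.
Proof.
move=> fb gb; apply: sup_norm_le; first by rewrite addr_ge0// sup_norm_ge0.
by move=> t; rewrite (le_trans (ler_normD _ _))// lerD// sup_norm_ub.
Qed.

Lemma sup_norm_eq0 f : bounded_map f -> sup_norm f = 0 -> f = 0.
Proof.
move=> fb f0; apply/funext => t; apply/eqP.
by rewrite -normr_le0 -f0; exact: sup_norm_ub.
Qed.

Lemma bounded_mapZ a f : bounded_map f -> bounded_map (a *: f).
Proof.
move=> fb; exists (`|a| * sup_norm f) => _ [t _ <-] /=.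
by rewrite normrZ ler_wpM2l// sup_norm_ub.
Qed.

Lemma sup_normZ a f : bounded_map f -> sup_norm (a *: f) = `|a| * sup_norm f.
Proof.
move=> fb; apply/eqP; rewrite eq_le; apply/andP; split.
  apply: sup_norm_le; first by rewrite mulr_ge0// sup_norm_ge0.
  by move=> t; rewrite normrZ ler_wpM2l// sup_norm_ub.
have [->|a0] := eqVneq a 0.
  by rewrite normr0 mul0r scale0r; apply: sup_norm_ge0; exists 0 => _ [t _ <-]; rewrite normr0.
have n0 : 0 < `|a| by rewrite normr_gt0.
rewrite -ler_pdivlMl//; apply: sup_norm_le.
  by rewrite mulr_ge0 ?invr_ge0// sup_norm_ge0//; exact: bounded_mapZ.
move=> t; rewrite ler_pdivlMl// -normrZ.
exact: (sup_norm_ub t (bounded_mapZ a fb)).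
Qed.

End sup_norm.

Lemma sup_norm_complete (R : realType) (T : Type) (X : completeNormedModType R)
    (V : normedModType R) (ev : V -> T -> X) :
  (forall u v t, ev (u - v) t = ev u t - ev v t) ->
  (forall v M, 0 <= M -> `|v| <= M <-> forall t, `|ev v t| <= M) ->
  (forall (F : set_system V) (g : T -> X), ProperFilter F ->
    (forall e, 0 < e -> \forall v \near F, forall t, `|g t - ev v t| <= e) ->
    exists w, ev w = g) ->
  forall F : set_system V, ProperFilter F -> cauchy F -> cvg F.
Proof.
move=> evB evM evg F FF Fc.
have Fcau e : 0 < e -> \forall v \near F & w \near F, `|v - w| <= e.
  move=> e0; have /cauchy_ballP /(_ e e0) := Fc.
  by apply: filterS => -[v w]/=; rewrite -ball_normE /= => /ltW.
have evc t : cvg (ev ^~ t @ F).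
  apply: (@cauchy_cvg _ (ev ^~ t @ F) _); apply/cauchy_ballP => e e0.
  have e20 : 0 < e / 2 by rewrite divr_gt0.
  have [[A B] [FA FB] AB] := Fcau _ e20.
  exists ((ev ^~ t) @` A, (ev ^~ t) @` B).
    by split; [apply: filterS FA|apply: filterS FB] => v Av; exists v.
  move=> [_ _] [/= [v Av <-] [w Bw <-]].
  rewrite -ball_normE /= -evB; apply: (@le_lt_trans _ _ (e / 2)).
    by have /evM := AB (v, w) (conj Av Bw); apply; exact: ltW.
  by rewrite ltr_pdivrMr// ltr_pMr// ltr1n.
pose g t := lim (ev ^~ t @ F).
have gF e : 0 < e -> \forall v \near F, forall t, `|g t - ev v t| <= e.
  move=> e0; have e20 : 0 < e / 2 by rewrite divr_gt0.
  have [[A B] [/= FA FB] AB] := Fcau _ e20.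
  apply: filterS FB => w Bw t.
  have /cvgrPdist_le /(_ _ e20) FC := evc t.
  have [v [Av /= gv]] := filter_ex (filterI FA FC).
  rewrite (splitr e) -(subrKA (ev v t)).
  rewrite (le_trans (ler_normD _ _))// lerD// -evB.
  by have /evM := AB (v, w) (conj Av Bw); apply; exact: ltW.
have [w wg] := evg F g FF gF.
apply: (cvgP w); apply/cvgrPdist_le => e e0.
apply: filterS (gF _ e0) => v gv; apply/evM; first exact: ltW.
by move=> t; rewrite evB wg.
Qed.

Section cfun_pred.
Context {R : realType} (K : compactHausdorffType) (X : normedModType R).

Definition continuous_pred : {pred (K -> X)} := mem [set f | continuous f].

Let continuous_submod_closed : submod_closed continuous_pred.
Proof.
split; first by rewrite inE /= => x; exact: cvg_cst.
move=> a f g; rewrite !inE /= => fc gc x.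
by apply: cvgD; [apply: cvgZr; exact: fc|exact: gc].
Qed.

HB.instance Definition _ :=
  GRing.isSubmodClosed.Build R (K -> X) continuous_pred continuous_submod_closed.

End cfun_pred.
Arguments continuous_pred {R} K X _.

(* C(K, X), normed below by sup_norm *)
Record cfun (R : realType) (K : compactHausdorffType) (X : normedModType R) :=
  CFun { cfun_val :> K -> X; _ : cfun_val \in continuous_pred K X }.

Section cfun.
Context {R : realType} (K : compactHausdorffType) (X : normedModType R).
Local Notation C := (cfun K X).

HB.instance Definition _ := [isSub for @cfun_val R K X].
HB.instance Definition _ := [Choice of C by <:].
HB.instance Definition _ := [SubChoice_isSubLmodule of C by <:].

Lemma cfun_continuous (f : C) : continuous f.
Proof. by have := valP f; rewrite inE. Qed.

Lemma cfun_bounded (f : C) : bounded_map f.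
Proof.
have cn : continuous (fun x => `|f x|).
  by move=> x; apply: cvg_norm; exact: cfun_continuous.
have /compact_bounded[M [_ HM]] : compact ((fun x => `|f x|) @` [set: K]).
  apply: continuous_compact; last exact: compactT.
  by apply: continuous_subspaceT.
exists (M + 1) => _ [t _ <-].
have := HM (M + 1); rewrite ltrDl ltr01 => /(_ isT `|f t|).
by move=> Ht; apply: le_trans (ler_norm _) (Ht _); exists t.
Qed.

Let cfun_normD (f g : C) : sup_norm (f + g : C) <= sup_norm f + sup_norm g.
Proof. by apply: sup_normD; exact: cfun_bounded. Qed.

Let cfun_normZ a (f : C) : sup_norm (a *: f : C) = `|a| * sup_norm f.
Proof. by apply: sup_normZ; exact: cfun_bounded. Qed.

Let cfun_norm_eq0 (f : C) : sup_norm f = 0 -> f = 0.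
Proof. by move=> f0; apply: val_inj; apply: sup_norm_eq0 => //; exact: cfun_bounded. Qed.

HB.instance Definition _ := @Lmodule_isNormed.Build R C
  (fun f => sup_norm f) cfun_normD cfun_normZ cfun_norm_eq0.

Lemma cfun_normE (f : C) : `|f| = sup_norm f.
Proof. by []. Qed.

End cfun.

Section cfun_complete.
Context {R : realType} (K : compactHausdorffType) (X : completeNormedModType R).

Let cfun_complete (F : set_system (cfun K X)) :
  ProperFilter F -> cauchy F -> cvg F.
Proof.
apply: (@sup_norm_complete R K X (cfun K X) (@cfun_val R K X)) => //.
  by move=> f M M0; rewrite cfun_normE; apply: sup_norm_leP => //; exact: cfun_bounded.
move=> {}F g FF gF.
suff gc : continuous g by have gC : g \in continuous_pred K X by [rewrite inE]; exists (CFun gC).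
move=> x; apply/cvgrPdist_le => e e0.
have e30 : 0 < e / 3 by rewrite divr_gt0.
have [f /= gf] := filter_ex (gF _ e30).
have /cvgrPdist_le /(_ _ e30) := @cfun_continuous _ _ _ f x.
apply: filterS => y fxy.
rewrite -(subrKA (f x)) -(subrKA (f y) (f x)).
have -> : e = e / 3 + (e / 3 + e / 3).
  by rewrite -mulr2n -mulrS -(mulr_natr (e / 3)) divfK// pnatr_eq0.
rewrite (le_trans (ler_normD _ _))// lerD// (le_trans (ler_normD _ _))// lerD//.
by rewrite distrC.
Qed.

HB.instance Definition _ := Uniform_isComplete.Build (cfun K X) cfun_complete.

End cfun_complete.

Section c0_pred.
Context (R : realType).

Definition null_pred : {pred (nat -> R^o)} := mem [set u : nat -> R^o | u @ \oo --> 0].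

Let null_submod_closed : submod_closed null_pred.
Proof.
split; first by rewrite inE /=; exact: cvg_cst.
move=> a u v; rewrite !inE /= => u0 v0.
rewrite -(addr0 0) -[X in _ --> X + _](scaler0 _ a).
by apply: cvgD => //; exact: cvgZr.
Qed.

HB.instance Definition _ :=
  GRing.isSubmodClosed.Build R (nat -> R^o) null_pred null_submod_closed.

End c0_pred.
Arguments null_pred R _ : clear implicits.

Record c0 (R : realType) :=
  C0 { c0_val :> nat -> R^o; _ : c0_val \in null_pred R }.

Section c0.
Context (R : realType).
Local Notation c0 := (c0 R).

HB.instance Definition _ := [isSub for @c0_val R].
HB.instance Definition _ := [Choice of c0 by <:].
HB.instance Definition _ := [SubChoice_isSubLmodule of c0 by <:].

Lemma c0_cvg (u : c0) : u @ \oo --> (0 : R^o).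
Proof. by have := valP u; rewrite inE. Qed.

Lemma c0_bounded (u : c0) : bounded_map u.
Proof.
have /cvg_seq_bounded[M [_ HM]] : cvgn (u : nat -> R^o) by apply: cvgP (@c0_cvg u).
exists (M + 1) => _ [n _ <-].
by have := HM (M + 1); rewrite ltrDl ltr01 => /(_ isT n I).
Qed.

Let c0_normD (u v : c0) : sup_norm (u + v : c0) <= sup_norm u + sup_norm v.
Proof. exact: (@sup_normD R nat R^o u v (c0_bounded u) (c0_bounded v)). Qed.

Let c0_normZ a (u : c0) : sup_norm (a *: u : c0) = `|a| * sup_norm u.
Proof. exact: (@sup_normZ R nat R^o a u (c0_bounded u)). Qed.

Let c0_norm_eq0 (u : c0) : sup_norm u = 0 -> u = 0.
Proof. by move=> u0; apply: val_inj; apply: sup_norm_eq0 => //; exact: c0_bounded. Qed.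

HB.instance Definition _ := @Lmodule_isNormed.Build R c0
  (fun u => sup_norm u) c0_normD c0_normZ c0_norm_eq0.

Lemma c0_normE (u : c0) : `|u| = sup_norm u.
Proof. by []. Qed.

Let c0_complete (F : set_system c0) : ProperFilter F -> cauchy F -> cvg F.
Proof.
apply: (@sup_norm_complete R nat R^o c0 (@c0_val R)) => //.
  by move=> u M M0; rewrite c0_normE; apply: sup_norm_leP => //; exact: c0_bounded.
move=> {}F g FF gF.
suff gc : g @ \oo --> (0 : R^o) by have gC : g \in null_pred R by [rewrite inE]; exists (C0 gC).
apply/cvgrPdist_le => e e0.
have e20 : 0 < e / 2 by rewrite divr_gt0.
have [u /= gu] := filter_ex (gF _ e20).
have /cvgrPdist_le /(_ _ e20) := @c0_cvg u.
apply: filterS => n; rewrite !sub0r !normrN => u0.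
rewrite -[g n](subrK (u n)) (splitr e).
by apply: le_trans (ler_normD _ _) _; apply: lerD => //; exact: gu.
Qed.

HB.instance Definition _ := Uniform_isComplete.Build c0 c0_complete.

End c0.

Section subspaces.
Context {R : realType}.
Implicit Types V W : normedModType R.

Definition closed_subspace V (S : set V) : Prop :=
  submod_closed (mem S : {pred V}) /\ closed S.

Definition complemented V (S : set V) : Prop :=
  closed_subspace S /\
  exists P : {linear V -> V},
    [/\ continuous P, forall v, P (P v) = P v & range P = S].

(* S, with the topology induced by V, is linearly homeomorphic to W *)
Definition isomorphic_to V (S : set V) W : Prop :=
  exists (T : {linear W -> V}) (T' : V -> W),
    [/\ continuous T, range T = S, cancel T T' & {within S, continuous T'}].

Definition contains_copy V W : Prop :=
  exists S : set V, closed_subspace S /\ isomorphic_to S W.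

Definition contains_complemented_copy V W : Prop :=
  exists S : set V, complemented S /\ isomorphic_to S W.

End subspaces.

(* Main.v *)
From HB Require Import structures.
Require Import Defs.
From mathcomp Require Import all_boot all_order all_algebra finmap.
From mathcomp Require Import all_classical all_reals all_analysis.
From mathcomp Require Import zify ring lra.

(** Suppose that [X] contains no copy of c_0, and let [T] embed C([1, omega^omega])
   into C(L, X), L = beta N x [1, omega], with a left inverse [Q].  The intervals
   [(b, b + omega^k]] form trees of every finite depth: the children of an
   interval are disjoint and their suprema converge to its supremum.  Let [v_s]
   be the image under [T] of the indicator of the interval [s], and [m_s] the
   functional given by [Q] followed by the evaluation at the supremum of [s].
   Then [m_s v_s = 1], [m_t -> m_s] weak-* along the children [t] of [s], and
   [v_t -> 0] pointwise along these children: at each point the [v_t] form a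
   weakly unconditionally Cauchy series in [X], so by Bessaga and Pelczynski
   their norms tend to [0].

   If L were just beta N, descending the tree would give functions [u] of norm at
   most [|T|] on which [m_s] takes arbitrarily large values: given [u] at [s],
   replace it by [v_t], [t] a child of [s], on the set where [v_t] is not small.
   These sets are point-finite, and the scalar measures [D |-> m_t (u 1_D)]
   converge on every subset of N, so by Phillips' lemma they are uniformly
   exhaustive and, by an Egorov argument, what is lost from [u] tends to [0].
   Hence [m_t u] increases by almost [1] at each step.

   For L itself, deep in the tree one can choose nodes below which the part of
   [m_s] carried by the copies of beta N at finite levels is almost maximal and
   almost carried by the levels up to some [p].  The levels strictly between [p]
   and omega are then negligible, and retracting them to the level omega reduces
   the argument to finitely many copies of beta N. *)

Set Implicit Arguments.
Unset Strict Implicit.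
Unset Printing Implicit Defensive.

Import Order.TTheory GRing.Theory Num.Theory.
Import numFieldNormedType.Exports.

Local Open Scope classical_set_scope.
Local Open Scope ring_scope.

(** * Finitely additive set functions *)

Lemma seq_choice (T : Type) (P : T -> T -> Prop) (x0 : T) :
  (forall x, exists y, P x y) ->
  exists f : nat -> T, f 0 = x0 /\ forall n, P (f n) (f n.+1).
Proof. by move=> /choice[g gP]; exists (fun n => iter n g x0). Qed.

Lemma le_of_increasing (e : nat -> nat) :
  {homo e : m n / (m < n)%N} -> forall n, (n <= e n)%N.
Proof. by move=> eM; elim=> // n IH; rewrite (leq_ltn_trans IH)// eM. Qed.

Lemma compact_decreasing_point (L : topologicalType) (F : nat -> set L) :
  compact [set: L] -> (forall n, closed (F n)) ->
  (forall m n, (m <= n)%N -> F n `<=` F m) -> (forall n, F n !=set0) ->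
  exists l, forall n, F n l.
Proof.
move=> cL cF decF F0; have [x xF] := choice F0.
have [|l [_ cl]] := cL (x @ \oo) _; first exact: filterT.
exists l => n; apply: cF => B lB; apply: cl => //.
by exists n => // m /= nm; apply: decF nm _ (xF m).
Qed.

Section finitely_additive.
Context {R : realType}.

Definition finitely_additive J (mu : set J -> R) :=
  forall A B, A `&` B = set0 -> mu (A `|` B) = mu A + mu B.

(** Uniform exhaustivity, stated by what it excludes: disjoint sets whose measures along a
    subsequence of [mu] all exceed [d]. *)
Definition exhaustive J (mu : nat -> set J -> R) :=
  forall (d : R) (B : nat -> set J) (i : nat -> nat), 0 < d ->
    trivIset setT B -> {homo i : m n / (m < n)%N} ->
    exists k, `|mu (i k) (B k)| <= d.

Lemma finitely_additiveID J (mu : set J -> R) A B :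
  finitely_additive mu -> mu A = mu (A `&` B) + mu (A `\` B).
Proof.
by move=> mua; rewrite -mua ?setUIDK// setDE setIACA setICr setI0.
Qed.

(** Otherwise uniting the sets of positive measure into [P] and those of negative measure into [Q]
    makes [mu P - mu Q] exceed [C + C]. *)
Lemma bounded_additive_disjoint J (mu : set J -> R) (C d : R)
    (B : nat -> set J) :
  finitely_additive mu -> (forall A, `|mu A| <= C) -> 0 < d ->
  trivIset setT B -> exists k, `|mu (B k)| <= d.
Proof.
move=> mua muC d0 tB; apply: contrapT => /forallNP nB.
have {}nB k : d < `|mu (B k)| by rewrite ltNge; apply/negP/nB.
have PQ n : exists P Q : set J, [/\ P `<=` \bigcup_(k < n) B k,
    Q `<=` \bigcup_(k < n) B k & n%:R * d <= mu P - mu Q].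
  elim: n => [|n [P [Q [PB QB PQd]]]].
    by exists set0, set0; split=> //; rewrite mul0r subrr.
  have step S : S `<=` \bigcup_(k < n) B k -> S `|` B n `<=` \bigcup_(k < n.+1) B k.
    move=> SB x [/SB[k /= kn Bk]|Bn]; last by exists n => //=.
    by exists k => //=; exact: ltnW.
  have dis S : S `<=` \bigcup_(k < n) B k -> S `&` B n = set0.
    move=> SB; rewrite -subset0 => x [/SB[k /= kn Bk] Bn].
    by have kE := tB k n I I (ex_intro _ x (conj Bk Bn)); rewrite kE ltnn in kn.
  have wk S : S `<=` \bigcup_(k < n) B k -> S `<=` \bigcup_(k < n.+1) B k.
    by move=> SB x /SB[k /= kn Bk]; exists k => //=; exact: ltnW.
  have := nB n; have [p|p] := leP 0 (mu (B n)) => dB.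
  - rewrite (ger0_norm p) in dB; exists (P `|` B n), Q; split; [exact: step|exact: wk|].
    by rewrite mua ?dis// -natr1 mulrDl mul1r; lra.
  - rewrite (ltr0_norm p) in dB; exists P, (Q `|` B n); split; [exact: wk|exact: step|].
    by rewrite mua ?dis// -natr1 mulrDl mul1r; lra.
have [n nC] : exists n : nat, C + C < n%:R * d.
  exists (Num.bound `|(C + C) / d|).
  by rewrite -ltr_pdivrMr// (le_lt_trans (ler_norm _))//; exact: archi_boundP.
have [P [Q [_ _ PQd]]] := PQ n.
have := ler_norm (mu P); have := ler_norm (- mu Q); rewrite normrN.
have := muC P; have := muC Q; lra.
Qed.

Lemma exhaustive_const J (mu : set J -> R) (C : R) :
  finitely_additive mu -> (forall A, `|mu A| <= C) ->
  exhaustive (fun=> mu).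
Proof. by move=> mua muC d B i d0 tB _; exact: bounded_additive_disjoint muC _ _. Qed.

Definition unbounded (M : set nat) := forall n, exists2 m, M m & (n <= m)%N.

(** Infinitely many disjoint unbounded parts of [M] cannot all contain a set of measure above
    [d]. *)
Lemma unbounded_small_variation (mu : set nat -> R) (C d : R) (M : set nat) :
  finitely_additive mu -> (forall A, `|mu A| <= C) -> 0 < d -> unbounded M ->
  exists M', [/\ M' `<=` M, unbounded M' & forall Q, Q `<=` M' -> `|mu Q| <= d].
Proof.
move=> mua muC d0 uM; apply: contrapT => /forallNP nM.
have [e [_ eP]] := @seq_choice nat (fun m n => M n /\ (m < n)%N) 0%N
  (fun m => let: ex_intro2 n Mn mn := uM m.+1 in ex_intro _ n (conj Mn mn)).
have einc : {homo e : m n / (m < n)%N}.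
  by apply: homo_ltn; [exact: ltn_trans|move=> n; have [] := eP n].
have einj : injective e.
  by move=> m n; case: (ltngtP m n) => // /einc + emn; rewrite emn ltnn.
(* The classes of the 2-adic valuation of the index; [e 0] is the seed [0], which may lie outside
   [M]. *)
pose N p := [set e n | n in [set n | (0 < n)%N /\ logn 2 n = p]].
have NM p : N p `<=` M.
  by move=> _ [[|n] [// _ _] <-]; have [] := eP n.
have uN p : unbounded (N p).
  move=> n; exists (e (2 ^ p * n.*2.+1)%N).
    exists (2 ^ p * n.*2.+1)%N => //=; split; first by rewrite muln_gt0 expn_gt0.
    rewrite lognM ?expn_gt0// pfactorK// lognE/= dvdn2/= odd_double/=.
    by rewrite addn0.
  apply: leq_trans (le_of_increasing einc _).
  rewrite -addnn; apply: leq_trans (leq_pmull _ (_ : 0 < 2 ^ p)%N); last first.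
    by rewrite expn_gt0.
  by rewrite -addnS leq_addr.
have /choice[Q QP] p : exists Q, Q `<=` N p /\ d < `|mu Q|.
  apply: contrapT => /forallNP nQ; apply: (nM (N p)); split=> // Q QN.
  by rewrite leNgt; apply/negP => dQ; exact: (nQ Q).
have [|k] := @bounded_additive_disjoint _ mu C d Q mua muC d0.
  by move=> p q _ _ [x [/(QP p).1[m [_ <-] <-] /(QP q).1[n [_ <-] /einj->]]].
by rewrite leNgt (QP k).2.
Qed.

(* The gliding hump of Phillips' lemma: if the conclusion fails, an unbounded
   set is built whose measures under infinitely many [nu k] stay above [d / 2]. *)
Lemma phillips_singletons (nu : nat -> set nat -> R) (C d : R) :
  (forall k, finitely_additive (nu k)) -> (forall k A, `|nu k A| <= C) ->
  (forall A, nu k A @[k --> \oo] --> 0) -> 0 < d ->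
  exists k, `|nu k [set k]| <= d.
Proof.
move=> nua nuC nu0 d0; apply: contrapT => /forallNP nk.
have {}nk k : d < `|nu k [set k]| by rewrite ltNge; apply/negP/nk.
have d4 : 0 < d / 4 by rewrite divr_gt0.
(* A state holds the points chosen so far, the last one and the reservoir for later ones. The
   premise [unbounded M] gives every state a successor. *)
pose good (s t : set nat * nat * set nat) := 
  let: (F, _, M) := s in let: (F', k, M') := t in
  unbounded M -> [/\ M k /\ F' = F `|` [set k], `|nu k F| <= d / 4, unbounded M',
     M' `<=` [set m | M m /\ (k < m)%N] &
     forall Q, Q `<=` M' -> `|nu k Q| <= d / 4].
have [|f [f0 fP]] := @seq_choice _ good (set0, 0%N, setT).
  move=> [[F k0] M]; have [uM|nM] := pselect (unbounded M); last by exists (F, k0, M).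
  have /cvgr0Pnorm_le /(_ _ d4)[K _ KP] := nu0 F.
  have [k Mk Kk] := uM K.
  have uM' : unbounded [set m | M m /\ (k < m)%N].
    move=> n; have [m Mm] := uM (n + k).+1; exists m; last by lia.
    by split=> //; lia.
  have [M' [MM' uM'' QM']] := unbounded_small_variation (nua k) (nuC k) d4 uM'.
  exists (F `|` [set k], k, M') => _; split=> //.
  exact: KP.
pose F n := (f n).1.1; pose k n := (f n).1.2; pose M n := (f n).2.
have fE n : f n = (F n, k n, M n) by rewrite /F /k /M; case: (f n) => [[]].
have uM n : unbounded (M n).
  elim: n => [|n IH]; first by rewrite /M f0 => m; exists m.
  by have := fP n; rewrite !fE /= => /(_ IH)[].
have {}fP n : [/\ M n (k n.+1) /\ F n.+1 = F n `|` [set k n.+1],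
    `|nu (k n.+1) (F n)| <= d / 4,
    M n.+1 `<=` [set m | M n m /\ (k n.+1 < m)%N] &
    forall Q, Q `<=` M n.+1 -> `|nu (k n.+1) Q| <= d / 4].
  by have := fP n; rewrite !fE /= => /(_ (uM n))[].
have MS m n : (m <= n)%N -> M n `<=` M m.
  elim: n => [|n IH]; first by rewrite leqn0 => /eqP->.
  rewrite leq_eqVlt ltnS => /predU1P[->//|/IH nm] x.
  by have [_ _ MM _] := fP n => /MM[/nm].
have kinc n : (k n.+1 < k n.+2)%N.
  by have [_ _ MM _] := fP n; have [[/MM[]]] := fP n.+1.
have kge n : (n <= k n.+1)%N.
  by elim: n => // n IH; rewrite (leq_ltn_trans IH)// kinc.
pose S := [set k n.+1 | n in setT].
have FS n : F n `<=` S.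
  elim: n => [|n IH]; first by rewrite /F f0.
  by have [[_ ->] _ _ _] := fP n => x [/IH//|->]; exists n.
have SF m n : (m < n)%N -> F n (k m.+1).
  elim: n => // n IH; rewrite ltnS leq_eqVlt.
  by have [[_ ->] _ _ _] := fP n => /predU1P[->|/IH]; [right|left].
have FM n : F n `&` M n = set0.
  elim: n => [|n IH]; first by rewrite /F f0 set0I.
  rewrite -subset0 => x; have [[_ ->] _ MM _] := fP n => -[[Fx /MM[Mx _]|->]].
    by have : (F n `&` M n) x by []; rewrite IH.
  by move=> /MM[_]; rewrite ltnn.
have SE n : S = F n `|` ([set k n.+1] `|` (S `&` M n.+1)).
  apply/seteqP; split=> [_ [m _ <-]|x [/FS//|[->|[]//]]]; last by exists n.
  case: (ltngtP m n) => [/SF|nm|->]; [by left|right; right|by right; left].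
  split; first by exists m.
  by apply: MS nm _ _; have [[]] := fP m.
(* Earlier and later points of [S] contribute at most [d / 4] each, against more than [d] at
   [k n.+1]. *)
have Sge n : d / 2 <= `|nu (k n.+1) S|.
  have [[Mk _] nuF MM nuQ] := fP n.
  rewrite (SE n) nua; last first.
    rewrite -subset0 => x [Fx [xk|[_ /MM[Mx _]]]];
      have : (F n `&` M n) x by split; rewrite // xk.
    1,2: by rewrite FM.
  rewrite nua; last by rewrite -subset0 => x [-> [_ /MM[_]]]; rewrite ltnn.
  have := nuQ (S `&` M n.+1) (@subIsetr _ _ _).
  have := nk (k n.+1).
  move: (nu _ (F n)) nuF (nu _ (S `&` _)) (nu _ [set _]) => x xd y z dz yd.
  have : `|z| <= `|x + (z + y)| + `|x| + `|y|.
    rewrite -(normrN x) -(normrN y).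
    apply: le_trans (lerD (ler_normD _ _) (lexx _)); apply: le_trans (ler_normD _ _).
    by rewrite le_eqVlt; apply/orP; left; apply/eqP; congr `|_|; lra.
  by lra.
have /cvgr0Pnorm_le /(_ _ d4)[K _ KP] := nu0 S.
have := KP (k K.+1) (kge K); have := Sge K => /=; lra.
Qed.

(** Phillips' lemma is applied to the measures [Q |-> mu (i k) (\bigcup_(m in Q) B m)], whose value
    at [[set k]] is [mu (i k) (B k)]. *)
Lemma exhaustive_cvg0 J (mu : nat -> set J -> R) (C : R) :
  (forall i, finitely_additive (mu i)) -> (forall i A, `|mu i A| <= C) ->
  (forall A, mu i A @[i --> \oo] --> 0) -> exhaustive mu.
Proof.
move=> mua muC mu0 d B i d0 tB iinc.
pose nu k (Q : set nat) := mu (i k) (\bigcup_(m in Q) B m).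
have [||||k] := @phillips_singletons nu C d.
- move=> k P Q PQ0; rewrite /nu bigcup_setU mua//.
  rewrite -subset0 => x [[p Pp Bp] [q Qq Bq]].
  have pq := tB p q I I (ex_intro _ x (conj Bp Bq)).
  by have : (P `&` Q) p by [split=> //; rewrite pq]; rewrite PQ0.
- by move=> k Q; exact: muC.
- move=> Q; apply: (cvg_comp i (fun j => mu j (\bigcup_(m in Q) B m)) _ (mu0 _)).
  apply/cvgnyPge => n; exists n => //= m nm.
  exact: leq_trans nm (le_of_increasing iinc m).
- by [].
- by rewrite /nu bigcup_set1 => ?; exists k.
Qed.

(* An Egorov theorem along a sequence of set functions. [hat] plays the role of
   the passage from a subset of [J] to its clopen closure in a
   compactification [L] of [J]. *)
Lemma exhaustive_egorov (L : topologicalType) J (hat : set J -> set L)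
    (mu : nat -> set J -> R) (A : nat -> set J) :
  compact [set: L] -> (forall D, closed (hat D)) -> hat set0 = set0 ->
  (forall D E, hat (D `|` E) = hat D `|` hat E) ->
  (forall n, finitely_additive (mu n)) ->
  (forall n D, hat D = set0 -> mu n D = 0) -> exhaustive mu ->
  (forall l, \forall n \near \oo, ~ hat (A n) l) ->
  mu n (A n) @[n --> \oo] --> 0.
Proof.
move=> cL hatC hat0 hatU mua muhat exh Afin.
have hatS D E : D `<=` E -> hat D `<=` hat E.
  by move=> /setUidPr <-; rewrite hatU => x; left.
apply: contrapT => /cvgr0Pnorm_lt /existsNP[d /not_implyP[d0 nd]].
have {}nd n : exists2 i, (n <= i)%N & d <= `|mu i (A i)|.
  apply: contrapT => /forall2NP h; apply: nd; exists n => // i /= ni.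
  by rewrite ltNge; apply/negP; have [] := h i.
pose E j N := [set x | exists k, [/\ (j <= k)%N, (k <= N)%N & A k x]].
(* What later sets add to [E j (N j)] has small measure for all late indices: otherwise such
   additions, chosen successively past all earlier bounds, would be disjoint and contradict
   exhaustivity. *)
have /choice[N NP] j : exists N, (j <= N)%N /\ forall N' i B, (N <= N')%N -> (N <= i)%N ->
    B `<=` E j N' `\` E j N -> `|mu i B| <= d / 2 / 2 ^+ j.+1.
  set dj := d / 2 / 2 ^+ j.+1.
  have dj0 : 0 < dj by rewrite !divr_gt0// exprn_gt0.
  apply: contrapT => /forallNP nN.
  have {}nN N : exists q : nat * nat * set J, (j <= N)%N ->
      [/\ (N <= q.1.1)%N, (N <= q.1.2)%N,
      q.2 `<=` E j q.1.1 `\` E j N & dj < `|mu q.1.2 q.2|].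
    apply: contrapT => /forallNP h; apply: (nN N).
    have [jN|jN] := leqP j N; last first.
      by exfalso; apply: (h (0%N, 0%N, set0)) => jN'; rewrite leqNgt jN in jN'.
    split=> // N' i B NN' Ni BE; rewrite leNgt; apply/negP => muB.
    by apply: (h (N', i, B)).
  have /choice[q qP] := nN.
  pose next N := (maxn (q N).1.1 (q N).1.2).+1.
  pose M k := iter k next j.
  have Mj k : (j <= M k)%N.
    elim: k => // k IH; rewrite /M iterS -/(M k).
    have [h _ _ _] := qP _ IH; rewrite /next; lia.
  have Mlt k : ((q (M k)).1.1 < M k.+1)%N /\ ((q (M k)).1.2 < M k.+1)%N.
    by rewrite /M iterS -/(M k) /next !ltnS leq_maxl leq_maxr.
  have Minc : {homo M : m n / (m <= n)%N}.
    apply: homo_leq; [exact: leqnn|exact: leq_trans|].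
    by move=> k; have [? _ _ _] := qP _ (Mj k); have [? _] := Mlt k; lia.
  have [| |k] := exh dj (fun k => (q (M k)).2) (fun k => (q (M k)).1.2) dj0.
  - move=> m n _ _ [x [Bm Bn]]; apply: contrapT => /eqP.
    wlog mn : m n Bm Bn / (m < n)%N.
      by rewrite neq_ltn => H /orP[mn|mn]; [apply: (H m n)|apply: (H n m)] => //;
        rewrite neq_ltn mn ?orbT.
    have [_ _ /(_ _ Bn)[_ nE] _] := qP _ (Mj n).
    have [_ _ /(_ _ Bm)[[p [jp pq Ap]] _] _] := qP _ (Mj m).
    case: nE; exists p; split=> //; have [h _] := Mlt m; have := Minc _ _ mn.
    by move: h pq; lia.
  - apply: homo_ltn; first exact: ltn_trans.
    move=> k; have [_ h] := Mlt k; have [_ h' _ _] := qP _ (Mj k.+1).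
    exact: leq_trans h h'.
  - by have [_ _ _] := qP _ (Mj k); rewrite ltNge => /negP.
pose G n := [set x | forall j, (j <= n)%N -> E j (N j) x].
have GS n : G n.+1 = G n `&` E n.+1 (N n.+1).
  apply/seteqP; split=> [x Gx|x [Gx Ex] j].
    by split=> [j jn|]; apply: Gx => //; exact: leqW.
  by rewrite leq_eqVlt => /predU1P[->//|]; exact: Gx.
(* Intersecting [A i] with the sets [E j (N j)] for [j <= n] costs at most the sum of the
   [d / 2 / 2 ^+ j.+1], that is [d / 2 - d / 2 / 2 ^+ n.+1]. *)
have muG n i : (forall j, (j <= n)%N -> (N j <= i)%N) -> d <= `|mu i (A i)| ->
    d / 2 + d / 2 / 2 ^+ n.+1 <= `|mu i (A i `&` G n)|.
  have small j D : (N j <= i)%N -> `|mu i ((A i `&` D) `\` E j (N j))| <= d / 2 / 2 ^+ j.+1.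
    move=> Ni; have [jN] := NP j; apply; [exact: Ni|exact: Ni|].
    move=> x [[Ax _] nE]; split=> //; exists i; split=> //.
    exact: leq_trans jN Ni.
  have split3 (x y z : R) : x = y + z -> `|x| <= `|y| + `|z| by move=> ->; exact: ler_normD.
  elim: n => [|n IH] Ni dA.
    have -> : G 0 = E 0 (N 0).
      by apply/seteqP; split=> [x|x Ex j]; [exact|rewrite leqn0 => /eqP->].
    have := small 0 setT (Ni 0 isT); rewrite setIT expr1.
    have := split3 _ _ _ (finitely_additiveID (A i) (E 0 (N 0)) (mua i)).
    by move: dA; lra.
  have /IH /(_ dA) : forall j, (j <= n)%N -> (N j <= i)%N by move=> j /leqW/Ni.
  have := small n.+1 (G n) (Ni n.+1 (leqnn _)); rewrite GS setIA.
  have := split3 _ _ _ (finitely_additiveID (A i `&` G n) (E n.+1 (N n.+1)) (mua i)).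
  rewrite exprS invfM mulrA; set t := d / 2 / 2 ^+ n.+1; rewrite -/t.
  have -> : d / 2 / 2 * (2 ^+ n.+1)^-1 = t / 2 by rewrite /t; lra.
  lra.
have hatG n : hat (G n) !=set0.
  pose K := (\max_(j < n.+1) N j)%N.
  have [i Ki di] := nd K.
  have Ni j : (j <= n)%N -> (N j <= i)%N.
    rewrite -ltnS => jn; apply: leq_trans Ki.
    exact: (@leq_bigmax _ (fun j : 'I_n.+1 => N j) (Ordinal jn)).
  have := muG n i Ni di; apply: contraPP => /set0P/negP/negPn/eqP hG.
  rewrite muhat.
    have h : 0 <= d / 2 / 2 ^+ n.+1 by rewrite !divr_ge0 ?exprn_ge0// ltW.
    by rewrite normr0; lra.
  by rewrite -subset0 -hG; apply: hatS; exact: subIsetr.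
have [n||l lG] := @compact_decreasing_point L (hat \o G) cL _ _ hatG.
- exact: hatC.
- move=> m n mn; apply: hatS => x Gx j jm; apply: Gx; exact: leq_trans jm mn.
(* The point [l] lies in no [hat (A k)] with [k >= K], hence not in the hat of their finite union
   [E K (N K)], although it lies in [hat (G K)]. *)
have [K _ KP] := Afin l.
have : hat (E K (N K)) l.
  by apply: (hatS (G K)); [move=> x; exact|exact: lG].
elim: (N K) => [|n IH].
  have -> : E K 0 = if K == 0%N then A 0%N else set0.
    apply/seteqP; case: eqP => [->|K0]; split=> x //.
    - by move=> [k []]; case: k.
    - by exists 0%N.
    - by move=> [k []]; rewrite leqn0 => /[swap]/eqP->; rewrite leqn0 => /eqP.
  by case: eqP => [K0|_]; [apply: KP; rewrite /= K0|rewrite hat0].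
have [Kn|nK] := leqP K n.+1; last first.
  rewrite (_ : E K n.+1 = set0) ?hat0// -subset0 => x [k [Kk kn _]].
  by have := leq_trans Kk kn; rewrite leqNgt nK.
rewrite (_ : E K n.+1 = E K n `|` A n.+1).
  by rewrite hatU => -[/IH//|]; exact: KP.
apply/seteqP; split=> x.
  by move=> [k []] Kk; rewrite leq_eqVlt ltnS => /predU1P[->|kn Ak];
    [right|left; exists k].
by move=> [[k [Kk kn Ak]]|An]; [exists k; split=> //; exact: leqW|exists n.+1].
Qed.

End finitely_additive.

(** * Copies of c_0 *)

Section bounded_below.
Context {R : realType}.

Lemma contains_copy_bounded_below (X W : completeNormedModType R)
    (U : {linear W -> X}) (C c : R) :
  0 < c -> (forall w, `|U w| <= C * `|w|) -> (forall w, c * `|w| <= `|U w|) ->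
  contains_copy X W.
Proof.
move=> c0 UC Uc.
have UB v w : c * `|v - w| <= `|U v - U w| by rewrite -linearB.
have Ucont : continuous U.
  apply: bounded_linear_continuous; apply/linear_boundedP.
  have : \forall r \near +oo, C <= r by apply: nbhs_pinfty_ge; exact: num_real.
  apply: filterS => r Cr w; apply: le_trans (UC w) _; exact: ler_wpM2r.
have /choice[T' T'P] x : exists w, range U x -> U w = x.
  by have [[w _ wx]|] := pselect (range U x); [exists w|exists 0].
have UT' : cancel U T'.
  move=> w; apply/eqP; rewrite -subr_eq0 -normr_eq0.
  have := UB (T' (U w)) w; rewrite T'P; last by exists w.
  by rewrite subrr normr0 pmulr_rle0// normr_le0 normr_eq0.
exists (range U); split; last first.
  exists U, T'; split=> //; apply/subspace_continuousP => x Sx.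
  apply/cvgrPdist_le => e e0; near=> y.
  have Sy : range U y by near: y; exact: withinT.
  rewrite -(ler_pM2l c0); apply: le_trans (UB _ _) _; rewrite !T'P//.
  near: y; apply: cvg_within.
  exact: (cvgr_dist_le _ _ (@cvg_id _ _) _ (mulr_gt0 c0 e0)).
split.
  split; first by rewrite inE; exists 0 => //; exact: linear0.
  move=> a x y; rewrite !inE => -[v _ <-] [w _ <-].
  by exists (a *: v + w) => //; rewrite linearP.
move=> x clx.
have xU e : 0 < e -> exists w, `|x - U w| < e.
  move=> e0; have [_ [[w _ <-] xw]] := clx _ (nbhsx_ballx x e e0).
  by exists w; rewrite -ball_normE in xw.
(* The vectors mapped close to [x] form a Cauchy filter, [U] being bounded below; its limit is
   mapped to [x]. *)
pose F := filter_from [set e : R | 0 < e] (fun e => [set w | `|x - U w| < e]).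
have FF : ProperFilter F.
  apply: filter_from_proper => [|e /= e0]; last exact: xU.
  apply: filter_from_filter; first by exists 1 => /=.
  move=> i j i0 j0; exists (Order.min i j); first by rewrite /= lt_min i0.
  by move=> w /=; rewrite lt_min => /andP.
have Fc : cauchy F.
  apply/cauchy_ballP => e e0; have ce : 0 < c * e / 2 by rewrite divr_gt0// mulr_gt0.
  exists ([set w | `|x - U w| < c * e / 2], [set w | `|x - U w| < c * e / 2]).
    by split; exists (c * e / 2).
  move=> [v w] [/= xv xw]; rewrite -ball_normE /= -(ltr_pM2l c0).
  apply: le_lt_trans (UB _ _) _; rewrite -(subrKA x).
  apply: le_lt_trans (ler_normD _ _) _; rewrite distrC.
  by move: xv xw; lra.
have /cvg_ex[w Fw] := @cauchy_cvg W F FF Fc.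
exists w => //; apply: (@norm_cvg_unique _ _ (U @ F)).
  by apply: cvg_trans (Ucont w); exact: cvg_app.
by apply/cvgrPdist_lt => e e0; exists e.
Unshelve. all: by end_near. Qed.

End bounded_below.

Section c0_sequences.
Context {R : realType}.

(** The unit ball of l_infinity: partial sums bounded over it characterize weakly unconditionally
    Cauchy series. *)
Definition box (a : nat -> R) := forall i, `|a i| <= 1.

(** The sequence [b] carries [a i] at the position [k i] and vanishes off the range of [k]. *)
Lemma subseries (X : normedModType R) (x : nat -> X) (k : nat -> nat)
    (a : nat -> R) :
  {homo k : m n / (m < n)%N} -> box a -> exists2 b, box b &
  forall n m, (n <= m)%N -> \sum_(n <= i < m) a i *: x (k i) =
     \sum_(k n <= j < k m) b j *: x j.
Proof.
move=> kinc a1.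
have kinj : injective k.
  by move=> m n; case: (ltngtP m n) => // /kinc + kmn; rewrite kmn ltnn.
have /choice[b bP] j : exists bj, (forall i, k i = j -> bj = a i) /\
    ((forall i, k i <> j) -> bj = 0).
  have [[i ij]|nj] := pselect (exists i, k i = j).
    exists (a i); split; first by move=> i' ij'; congr a; apply: kinj; rewrite ij ij'.
    by move=> /(_ i).
  by exists 0; split=> // i ij; exfalso; apply: nj; exists i.
exists b.
  move=> j; have [[i ij]|nj] := pselect (exists i, k i = j).
    by rewrite ((bP j).1 _ ij).
  by rewrite ((bP j).2 _) ?normr0// => i ij; apply: nj; exists i.
move=> n; elim=> [|m IH].
  by rewrite leqn0 => /eqP->; rewrite !big_geq.
rewrite leq_eqVlt => /predU1P[<-|]; first by rewrite !big_geq.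
rewrite ltnS => nm; rewrite big_nat_recr//= IH//.
have kle : (k n <= k m)%N.
  by move: nm; rewrite leq_eqVlt => /predU1P[->//|/kinc/ltnW].
have kS := kinc _ _ (ltnSn m).
rewrite (@big_cat_nat _ _ _ (k m) (k n) (k m.+1))//=; last exact: ltnW.
rewrite (big_ltn kS) ((bP (k m)).1 m erefl).
rewrite [X in _ + (_ + X)]big_nat_cond [X in _ + (_ + X)]big1 ?addr0//.
move=> j /andP[/andP[mj jm] _]; rewrite ((bP j).2 _) ?scale0r// => i ij.
move: mj jm; rewrite -ij => mj jm.
have im : (m < i)%N.
  rewrite ltnNge; apply/negP; rewrite leq_eqVlt => /predU1P[im|/kinc].
    by rewrite im ltnn in mj.
  by rewrite ltnNge ltnW.
move: im; rewrite leq_eqVlt => /predU1P[mi|/kinc]; last by rewrite ltnNge ltnW.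
by rewrite mi ltnn in jm.
Qed.

Variables (X : normedModType R) (x : nat -> X) (C : R).
Hypothesis xC : forall n a, box a -> `|\sum_(0 <= i < n) a i *: x i| <= C.

Lemma box_sumC m n a : box a -> `|\sum_(m <= i < n) a i *: x i| <= C.
Proof.
move=> a1; have [nm|/ltnW mn] := leqP n m.
  by rewrite big_geq// normr0; apply: le_trans (xC 0 a1).
have -> : \sum_(m <= i < n) a i *: x i =
    \sum_(0 <= i < n) (if (i < m)%N then 0 else a i) *: x i.
  rewrite (@big_cat_nat _ _ _ m 0 n)//= [X in _ = X + _]big_nat_cond [X in _ = X + _]big1 ?add0r.
    by apply: eq_big_nat => i /andP[mi _]; rewrite ltnNge mi.
  by move=> i /andP[/andP[_ ->] _]; rewrite scale0r.
by apply: xC => i; case: ifP; rewrite ?normr0.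
Qed.

Lemma scaled_box_sumC m n a t : 0 <= t ->
  (forall i, (m <= i)%N -> `|a i| <= t) ->
  `|\sum_(m <= i < n) a i *: x i| <= t * C.
Proof.
rewrite le_eqVlt => /predU1P[<- a0|t0 at_].
  rewrite big_nat_cond big1 ?normr0 ?mul0r// => i /andP[/andP[/a0]].
  by rewrite normr_le0 => /eqP->; rewrite scale0r.
pose b i := if (m <= i)%N then t^-1 * a i else 0.
have b1 : box b.
  move=> i; rewrite /b; case: ifP; rewrite ?normr0// => /at_.
  by rewrite normrM gtr0_norm ?invr_gt0// ler_pdivrMl// mulr1.
have -> : \sum_(m <= i < n) a i *: x i = t *: \sum_(m <= i < n) b i *: x i.
  rewrite scaler_sumr; apply: eq_big_nat => i /andP[mi _].
  by rewrite /b mi scalerA mulrA divff ?gt_eqF// mul1r.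
by rewrite normrZ gtr0_norm// ler_pM2l// box_sumC.
Qed.

End c0_sequences.

Section c0_subsequences.
Context {R : realType}.
Variables (X : normedModType R) (x : nat -> X) (C : R).
Hypothesis xC : forall n a, box a -> `|\sum_(0 <= i < n) a i *: x i| <= C.

(* If infinitely many successive blocks could shorten [y] by [e], the average of
   [y] plus these blocks would be too short, as the sum of the blocks is
   bounded. *)
Lemma box_tail y e : 0 < e -> exists N, forall n a, (N <= n)%N -> box a ->
  forall m, `|y| - e <= `|y + \sum_(n <= i < m) a i *: x i|.
Proof.
move=> e0; apply: contrapT => /forallNP nN.
have blocks k : exists n a, box a /\
    `|k%:R *: y + \sum_(0 <= i < n) a i *: x i| <= k%:R * (`|y| - e).
  elim: k => [|k [n [a [a1 IH]]]].
    by exists 0%N, (fun=> 0); split=> [i|];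
      rewrite ?normr0// big_geq// scale0r addr0 normr0 mul0r.
  have /existsNP[n' /existsNP[b /not_implyP[nn' /not_implyP[b1 /existsNP[m]]]]] := nN n.
  move=> /negP; rewrite -ltNge => blt.
  have n'm : (n' <= m)%N.
    rewrite leqNgt; apply/negP => /ltnW mn; move: blt.
    by rewrite big_geq// addr0 ltNge gerBl ltW.
  exists m, (fun i => if (i < n)%N then a i else if (i < n')%N then 0 else b i); split.
    by move=> i; case: ifP => // _; case: ifP; rewrite ?normr0.
  rewrite (@big_cat_nat _ _ _ n 0 m)//=; last exact: leq_trans nn' n'm.
  rewrite (@big_cat_nat _ _ _ n' n m)//=.
  rewrite (@eq_big_nat _ _ _ 0%N n _ (fun i => a i *: x i)); last by move=> i /andP[_ ->].
  rewrite [X in _ + (_ + (X + _))]big_nat_cond [X in _ + (_ + (X + _))]big1 ?add0r; last first.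
    by move=> i /andP[/andP[ni ->] _]; rewrite ltnNge ni scale0r.
  rewrite (@eq_big_nat _ _ _ n' m _ (fun i => b i *: x i)); last first.
    by move=> i /andP[ni _]; rewrite !ltnNge ni (leq_trans nn').
  rewrite -natr1 scalerDl scale1r addrACA mulrDl mul1r.
  apply: le_trans (ler_normD _ _) _; apply: lerD => //; exact: ltW.
pose k := Num.bound `|C / e|; have [n [a [a1]]] := blocks k.
apply/negP; rewrite -ltNge.
have kC : C < k%:R * e.
  by rewrite -ltr_pdivrMr// (le_lt_trans (ler_norm _))//; exact: archi_boundP.
have := xC n a1; move: (\sum_(_ <= _ < _) _) => s sC.
have := lerB_normD (k%:R *: y) s; rewrite normrZ ger0_norm//.
move: kC; rewrite mulrBr; lra.
Qed.

(** For [g] a finite net of [[-1, 1]], a finite net of the combinations with coefficients in the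
    box: one tail index serves all of them. *)
Fixpoint spans (z : nat -> X) (g : seq R) n : seq X :=
  if n is n'.+1 then [seq y + c *: z n' | y <- spans z g n', c <- g]
  else [:: 0].

Lemma mem_spans z g (a : nat -> R) n : (forall i, a i \in g) ->
  \sum_(0 <= i < n) a i *: z i \in spans z g n.
Proof.
move=> ag; elim: n => [|n IH]; first by rewrite big_geq// mem_head.
rewrite big_nat_recr//=.
apply/allpairsP; exists (\sum_(0 <= i < n) a i *: z i, a n).
by split=> //=; exact: ag.
Qed.

Lemma finite_box_tail (s : seq X) e : 0 < e ->
  exists N, forall y n a, y \in s -> (N <= n)%N -> box a ->
  forall m, `|y| - e <= `|y + \sum_(n <= i < m) a i *: x i|.
Proof.
move=> e0; elim: s => [|y s [N NP]]; first by exists 0%N.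
have [M MP] := box_tail y e0; exists (maxn N M) => z n a.
rewrite inE geq_max => /predU1P[->|zs] /andP[Nn Mn]; [exact: MP|exact: NP].
Qed.

(** Each [k n] is taken beyond the tail index of the finitely many grid combinations of the terms
    selected before it. *)
Lemma grid_selection (g : seq R) d e : 0 < e ->
  (forall N, exists2 i, (N <= i)%N & d <= `|x i|) ->
  exists k : nat -> nat, [/\ {homo k : m n / (m < n)%N},
    forall n, d <= `|x (k n)| &
    forall n y a m, y \in spans (x \o k) g n -> box a ->
      `|y| - e <= `|y + \sum_(k n <= i < m) a i *: x i| ].
Proof.
move=> e0 xd.
pose good (s t : seq X * nat) := [/\ (s.2 < t.2)%N, d <= `|x t.2|,
   t.1 = [seq y + c *: x t.2 | y <- s.1, c <- g] &
   forall y a m, y \in s.1 -> box a ->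
     `|y| - e <= `|y + \sum_(t.2 <= i < m) a i *: x i| ].
have [|f [f0 fP]] := @seq_choice _ good ([:: 0], 0%N).
  move=> [Y k]; have [N NP] := finite_box_tail Y e0.
  have [k' Nk' xk'] := xd (maxn N k.+1); rewrite geq_max in Nk'.
  have /andP[Nk'' kk'] := Nk'.
  exists ([seq y + c *: x k' | y <- Y, c <- g], k'); split=> // y a m yY a1.
  exact: NP.
(* The shift by one drops the seed index [0], at which no term is selected. *)
exists (fun n => (f n.+1).2); split.
- by apply: homo_ltn => [|n]; [exact: ltn_trans|have [] := fP n.+1].
- by move=> n; have [] := fP n.
- move=> n y a m; have -> : spans (x \o fun n => (f n.+1).2) g n = (f n).1.
    by elim: n => [|n IH]; [rewrite f0|have [_ _ -> _] := fP n; rewrite /= IH].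
  by have [_ _ _] := fP n; exact.
Qed.

(** Rounding down to the grid of the points [j / K - 1], [0 <= j <= 2 K]. *)
Lemma rounding (K : nat) : (0 < K)%N -> exists (g : seq R) (r : R -> R),
  forall t, `|t| <= 1 -> r t \in g /\ `|t - r t| <= K%:R^-1.
Proof.
move=> K0; have K0' : 0 < K%:R :> R by rewrite ltr0n.
pose v j : R := j%:R / K%:R - 1.
exists [seq v j | j <- iota 0 K.*2.+1], (fun t => v (Num.truncn ((t + 1) * K%:R))).
move=> t; rewrite ler_norml => /andP[t1 t2].
have /truncn_itv/andP[lo hi] : 0 <= (t + 1) * K%:R by rewrite mulr_ge0//; lra.
set j := Num.truncn _ in lo hi *; split.
  apply: map_f; rewrite mem_iota add0n ltnS /= -(ler_nat R).
  apply: le_trans lo _; rewrite -muln2 natrM mulrC ler_pM2l//; lra.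
have -> : t - v j = ((t + 1) * K%:R - j%:R) / K%:R.
  by rewrite /v mulrBl mulfK ?gt_eqF//; lra.
rewrite normrM normfV (gtr0_norm K0') -[leRHS]mul1r ler_pM2r ?invr_gt0//.
by rewrite ger0_norm ?subr_ge0//; move: hi; rewrite -natr1; lra.
Qed.

(* A tail almost never shortens a partial sum [S_n], so
   [|a_n x_n| <= |S_n.+1| + |S_n|] bounds each full sum from below. *)
Lemma c0_lower_subsequence d : 0 < d ->
  (forall N, exists2 i, (N <= i)%N & d <= `|x i|) ->
  exists2 k : nat -> nat, {homo k : m n / (m < n)%N} &
    forall a t n m, (forall i, `|a i| <= t) -> (n < m)%N ->
      `|a n| * (d / 2) - t * (d / 4) <= `|\sum_(0 <= i < m) a i *: x (k i)|.
Proof.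
(* The norms of [S n] and [S n.+1] will exceed that of the full sum by at most [3 * e = d / 4] each:
   [e] for the tail and twice [e] for rounding. *)
move=> d0 xd; pose e := d / 12; have e0 : 0 < e by rewrite divr_gt0.
have C0 : 0 <= C.
  apply: le_trans (xC 0 (a := fun=> 0) _); first exact: normr_ge0.
  by move=> i; rewrite normr0.
pose K := (Num.bound (C / e)).+1.
have KC : K%:R^-1 * C <= e.
  rewrite ler_pdivrMl ?ltr0n// -ler_pdivrMr// (le_trans (ltW (archi_boundP _)))//.
    by rewrite divr_ge0// ltW.
  by rewrite ler_nat.
have [g [r rP]] := rounding (isT : (0 < K)%N).
have [k [kinc xk kP]] := grid_selection g e0 xd.
have zC n a : box a -> `|\sum_(0 <= i < n) a i *: x (k i)| <= C.
  by move=> /(subseries x kinc)[b b1 ->//]; exact: (box_sumC xC).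
exists k => // a t n m a_t nm.
have t0 : 0 <= t by apply: le_trans (a_t 0%N).
suff H b : box b -> `|b n| * (d / 2) - d / 4 <= `|\sum_(0 <= i < m) b i *: x (k i)|.
  move: t0; rewrite le_eqVlt => /predU1P[t0|t0].
    by have := a_t n; rewrite -t0 normr_le0 => /eqP->; rewrite normr0 !mul0r subr0.
  have /H : box (fun i => t^-1 * a i).
    by move=> i; rewrite normrM gtr0_norm ?invr_gt0// ler_pdivrMl// mulr1.
  rewrite -(ler_pM2l t0) mulrBr normrM (gtr0_norm (_ : 0 < t^-1)) ?invr_gt0//.
  rewrite -[_ * _ * (d / 2)]mulrA mulVKf ?gt_eqF// => /le_trans; apply.
  rewrite -{1}(gtr0_norm t0) -normrZ scaler_sumr le_eqVlt; apply/orP; left.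
  apply/eqP; congr `|_|; apply: eq_bigr => i _.
  by rewrite scalerA mulrA divff ?gt_eqF// mul1r.
move=> b1; pose S n := \sum_(0 <= i < n) b i *: x (k i).
have tail p : (p <= m)%N -> `|S p| - 3 * e <= `|S m|.
  move=> pm; pose y := \sum_(0 <= i < p) r (b i) *: x (k i).
  have Sy : `|S p - y| <= e.
    rewrite -sumrB (eq_bigr (fun i => (b i - r (b i)) *: x (k i))); last first.
      by move=> i _; rewrite scalerBl.
    apply: le_trans KC; apply: (scaled_box_sumC (x := x \o k) zC) => [|i _]; last first.
      by have [] := rP _ (b1 i).
    by rewrite invr_ge0.
  have [c c1 cE] := subseries x kinc b1.
  have yg : y \in spans (x \o k) g p.
    by apply: (mem_spans (x \o k)) => i; have [] := rP _ (b1 i).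
  have := kP p y c (k m) yg c1; rewrite -cE//.
  have -> : S m = (S p - y) + (y + \sum_(p <= i < m) b i *: x (k i)).
    by rewrite addrA subrK /S (@big_cat_nat _ _ _ p 0 m).
  move: (y + _) => w; have := ler_normD (S p - y) y; rewrite subrK.
  by have := lerB_normD w (S p - y); rewrite [w + _]addrC; lra.
have := tail n (ltnW nm); have := tail n.+1 nm.
have : `|b n| * d <= `|S n.+1| + `|S n|.
  apply: le_trans (ler_normB _ _); rewrite /S big_nat_recr//= [_ + _ - _]addrC addKr.
  by rewrite normrZ ler_wpM2l.
by rewrite /e -/(S m); lra.
Qed.

End c0_subsequences.

Section c0_copies.
Context {R : realType}.

(** The theorem of Bessaga and Pelczynski. The series of the [a i *: z i] converges because [a]
    tends to [0], and its sum is bounded below by the choice of the subsequence. *)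
Lemma contains_c0 (X : completeNormedModType R) (x : nat -> X) (C d : R) :
  (forall n a, box a -> `|\sum_(0 <= i < n) a i *: x i| <= C) -> 0 < d ->
  (forall N, exists2 i, (N <= i)%N & d <= `|x i|) -> contains_copy X (c0 R).
Proof.
move=> xC d0 xd; have [k kinc kP] := c0_lower_subsequence xC d0 xd.
pose z := x \o k.
have zC n a : box a -> `|\sum_(0 <= i < n) a i *: z i| <= C.
  by move=> /(subseries x kinc)[b b1 ->//]; exact: (box_sumC xC).
have C0 : 0 <= C.
  apply: le_trans (xC 0 (fun=> 0) _); first exact: normr_ge0.
  by move=> i; rewrite normr0.
pose S (a : nat -> R) n := \sum_(0 <= i < n) a i *: z i.
have Sc (a : c0 R) : cvgn (S a).
  apply/cauchy_cvgP/(@cauchy_seriesP _ _ (fun i => a i *: z i)) => e e0.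
  have eC : 0 < e / (C + 1) by rewrite divr_gt0// ltr_wpDl.
  have /cvgr0Pnorm_le /(_ _ eC)[N _ NP] := @c0_cvg _ a.
  exists ([set n | (N <= n)%N], [set n | (N <= n)%N]).
    by split; exists N.
  move=> [m n] [/= Nm Nn].
  apply: (@le_lt_trans _ _ (e / (C + 1) * C)).
    apply: (scaled_box_sumC zC) => [|i mi]; first exact: ltW.
    by apply: NP; exact: leq_trans mi.
  rewrite mulrAC ltr_pdivrMr ?ltr_wpDl//; nra.
pose U a := limn (S a).
have Ulin : linear (U : c0 R -> X).
  move=> r a b; apply: cvg_lim => //.
  rewrite (_ : S _ = r \*: S a + S b).
    by apply: cvgD; [apply: cvgZr|]; exact: Sc.
  apply/funext => n; transitivity (r *: S a n + S b n); last by [].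
  rewrite /S scaler_sumr -big_split/=.
  by apply: eq_bigr => i _; rewrite scalerDl scalerA.
pose UL : {linear c0 R -> X} := HB.pack (U : c0 R -> X)
  (GRing.isLinear.Build R (c0 R) X *:%R U Ulin).
have SU (a : c0 R) : `|S a n| @[n --> \oo] --> `|U a| by apply: cvg_norm; exact: Sc.
have an (a : c0 R) n : `|a n| <= `|a| by apply: sup_norm_ub; exact: c0_bounded.
apply: (@contains_copy_bounded_below _ X (c0 R) UL C (d / 4)).
- by rewrite divr_gt0.
- move=> a; apply: (cvgr_to_le (SU a)); near=> n.
  by rewrite mulrC; apply: (scaled_box_sumC zC) => // i _; exact: an.
- move=> a.
  (* With [t] the norm of [a], the limit in [m] and the supremum over [n] leave
     [d / 2 - d / 4 = d / 4] of that norm. *)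
  have H n : `|a n| <= (`|U a| + `|a| * (d / 4)) * (2 / d).
    rewrite -[2 / d]invf_div ler_pdivlMr ?divr_gt0//.
    rewrite -lerBlDr; apply: (cvgr_to_ge (SU a)); near=> m.
    apply: kP; first exact: an.
    by near: m; exact: nbhs_infty_gt.
  have : `|a| <= (`|U a| + `|a| * (d / 4)) * (2 / d).
    by apply: sup_norm_le H; rewrite mulr_ge0 ?divr_ge0 ?addr_ge0 ?mulr_ge0 ?divr_ge0// ltW.
  rewrite -[2 / d]invf_div ler_pdivlMr ?divr_gt0//= /U; lra.
Unshelve. all: by end_near. Qed.

End c0_copies.

(** * Ordinal intervals and clopen cuts *)

Section ordinal_intervals.
Context {d} (A : wellOrderType d).

Definition itv_above (a : A) : set (ord_itv1 A) :=
  [set x | if x is ItvBelow y _ then (a < y)%O else True].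

(* [x] as a point of [1, A]; the junk value at the least element is the top. *)
Definition itv_point (x : A) : ord_itv1 A :=
  if (x != \bot%O) =P true is ReflectT x0 then ItvBelow x0 else ItvTop.

Lemma itv_pointE (x : A) (x0 : x != \bot%O) : itv_point x = ItvBelow x0.
Proof.
rewrite /itv_point; case: eqP => // x0'.
by congr ItvBelow; exact: bool_irrelevance.
Qed.

Lemma itv_above_point (a x : A) : x != \bot%O -> itv_above a (itv_point x) = (a < x)%O.
Proof. by move=> x0; rewrite itv_pointE. Qed.

Lemma lt_below (a b : A) (a0 : a != \bot%O) (b0 : b != \bot%O) :
  (ItvBelow a0 < ItvBelow b0)%O = (a < b)%O.
Proof. by rewrite !ltNge. Qed.

Lemma lt_top (a : A) (a0 : a != \bot%O) : (ItvBelow a0 < ItvTop)%O.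
Proof. by rewrite ltNge. Qed.

Lemma lt_topF (x : ord_itv1 A) : (ItvTop < x)%O = false.
Proof. by rewrite ltNge; case: x. Qed.

(** The complement is the open ray below the least point above [a], which exists by
    well-ordering. *)
Lemma clopen_itv_above (a : A) : clopen (itv_above a).
Proof.
split.
  have [a0|a0] := eqVneq a \bot%O.
    rewrite (_ : itv_above a = setT); first exact: openT.
    by apply/seteqP; split=> // -[y y0|] _ //=; rewrite a0 lt0x.
  rewrite (_ : itv_above a = `]ItvBelow a0, +oo[%classic); first exact: rray_open.
  by apply/seteqP; split=> -[y y0|]; rewrite /= in_itv/= ?andbT ?lt_below ?lt_top.
rewrite -openC.
have [z az zmin] : exists2 z, itv_above a z & forall y, itv_above a y -> (z <= y)%O.
  have [[y [y0 ay]]|na] := pselect (exists y, exists y0 : y != \bot%O, (a < y)%O).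
    have [|z /= az zmin] := @well_ordered _ A [set z | (a < z)%O]; first by exists y.
    have z0 : z != \bot%O by apply: contraTneq az => ->; rewrite ltx0.
    by exists (ItvBelow z0) => // -[x x0|] //= ax; apply: zmin.
  by exists ItvTop => // -[x x0|] //= ax; exfalso; apply: na; exists x, x0.
rewrite (_ : ~` _ = `]-oo, z[%classic); first exact: lray_open.
apply/seteqP; split=> y; rewrite /= in_itv/=.
  move=> nay; rewrite ltNge; apply/negP => zy; apply: nay.
  case: z az zy {zmin} => [z z0|] /= az; case: y => [y y0|] //=.
  by move=> zy; apply: lt_le_trans az _.
by move=> yz /zmin; rewrite leNgt yz.
Qed.

Lemma itv_point_cvg (y : nat -> A) (x : A) : x != \bot%O ->
  (forall n, y n != \bot%O) -> (forall n, (y n <= x)%O) ->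
  (forall z, (z < x)%O -> \forall n \near \oo, (z < y n)%O) ->
  itv_point (y n) @[n --> \oo] --> itv_point x.
Proof.
move=> x0 y0 yx yz U; rewrite (@itv_nbhsE _ (ord_itv1 A)) => -[[l r] [oi]].
rewrite (itv_pointE x0) /= itv_boundlr => /andP[lx xr] iU.
have yr n : (BRight (itv_point (y n)) <= r)%O.
  apply: Order.POrderTheory.le_trans xr.
  by rewrite bnd_simp (itv_pointE (y0 n)); exact: yx.
suff : \forall n \near \oo, (l <= BLeft (itv_point (y n)))%O.
  by apply: filterS => n ln; apply: iU; rewrite /= itv_boundlr ln yr.
case: l oi lx {iU} => [b z|[]]; last 2 first.
- by move=> _ _; apply: filterE.
- by move=> _ .
move=> oi zx.
have b0 : b = false by case: (b) oi => //; case: (r) => [[]|[]].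
move: zx; rewrite b0 bnd_simp; case: z {oi} => [z z0|]; last by rewrite lt_topF.
rewrite lt_below => zx; apply: filterS (yz z zx) => n.
by rewrite bnd_simp (itv_pointE (y0 n)) lt_below.
Qed.

End ordinal_intervals.

Section ordinal_digits.
Implicit Types (b : ordpow nat nat) (k c : nat).

(* The Cantor normal form [b], cut below the exponent [k] and with coefficient
   [c] at [k]. *)
Definition digit b k c : ordpow nat nat := OrdPow
  [fsfun x in (k |` finsupp (ordpow_fun b))%fset =>
     if (x < k)%N then 0%N else if x == k then c else b x | (\bot : nat)%O].

Lemma digitE b k c x :
  digit b k c x = if (x < k)%N then 0%N else if x == k then c else b x.
Proof.
rewrite /digit /= fsfun_fun; case: ifPn => //.
rewrite in_fsetE negb_or in_fset1 => /andP[/negbTE -> xb].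
by rewrite (fsfun_dflt xb); case: ifP.
Qed.

Lemma digit_neq0 b k c : digit b k c.+1 != \bot%O.
Proof.
apply/eqP => h; have : digit b k c.+1 k = (\bot%O : ordpow nat nat) k by rewrite h.
by rewrite digitE ltnn eqxx [RHS]fsfun0E.
Qed.

Lemma digit_at b k c : digit b k c k = c.
Proof. by rewrite digitE ltnn eqxx. Qed.

Lemma digit_above b k c x : (k < x)%N -> digit b k c x = b x.
Proof. by move=> kx; rewrite digitE; case: ltngtP kx. Qed.

Lemma digit_below b k c x : (x < k)%N -> digit b k c x = 0%N.
Proof. by move=> xk; rewrite digitE xk. Qed.

Lemma digit_lt b k c c' : (c < c')%N -> (digit b k c < digit b k c')%O.
Proof.
move=> cc'; apply/ordpow_ltP; exists k; first by rewrite !digit_at.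
by move=> x kx; rewrite !digit_above.
Qed.

Lemma digit_ltS b k c : (digit b k c < digit b k.+1 (b k.+1).+1)%O.
Proof.
apply/ordpow_ltP; exists k.+1; first by rewrite digit_at digit_above// ltEnat /=.
by move=> x kx; rewrite !digit_above// ltnW.
Qed.

(** With [beta] the part of [b] at exponents above [k], the ordinals [beta + omega ^ k * c] are
    cofinal in [beta + omega ^ k.+1]. If [z] agrees with [b] above [k], its digit [z k] tells how
    large [c] must be. *)
Lemma digit_sup b k z : (z < digit b k.+1 (b k.+1).+1)%O ->
  \forall c \near \oo, (z < digit b k c.+1)%O.
Proof.
move=> /ordpow_ltP[x zx zE]; exists (z k) => // c /= zc; apply/ordpow_ltP.
have zb y : (x < y)%N -> (k.+1 < y)%N -> z y = b y.
  by move=> xy ky; rewrite zE// digit_above.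
have [kx|xk|xk] := ltngtP k.+1 x.
- exists x; first by move: zx; rewrite !digit_above// ltnW.
  move=> y xy; have ky := ltn_trans kx xy.
  by rewrite zb// digit_above// ltnW.
- by move: zx; rewrite digit_below.
move: zx; rewrite -xk digit_at ltEnat /= ltnS leq_eqVlt => /predU1P[zbk|zbk].
  exists k; first by rewrite digit_at; exact: zc.
  move=> y ky; have : (k < y)%N by []; rewrite leq_eqVlt => /predU1P[<-|{}ky].
    by rewrite digit_above.
  by rewrite zb -?xk// digit_above// ltnW.
exists k.+1; first by rewrite digit_above// ltEnat.
by move=> y ky; rewrite zb -?xk// digit_above// ltnW.
Qed.

End ordinal_digits.

Section cfun_cut.
Context {R : realType} (K : compactHausdorffType) (X : normedModType R).
Local Notation C := (cfun K X).
Implicit Types (A B : set K) (f g : C).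

Lemma continuous_if_clopen (Y : topologicalType) A (f g : K -> Y) : clopen A ->
  continuous f -> continuous g ->
  continuous (fun x => if `[< A x >] then f x else g x).
Proof.
move=> [oA cA] fc gc x; rewrite /continuous_at; case: asboolP => [Ax|nAx].
  apply: cvg_trans (fc x); apply: near_eq_cvg.
  have : \forall y \near x, A y by apply: open_nbhs_nbhs.
  by apply: filterS => y Ay; rewrite asboolT.
apply: cvg_trans (gc x); apply: near_eq_cvg.
have : \forall y \near x, (~` A) y.
  by apply: open_nbhs_nbhs; split=> //; rewrite openC.
by apply: filterS => y nAy; rewrite asboolF.
Qed.

(** The junk value [0] at discontinuous maps makes [cut] total. *)
Definition cfun_of (f : K -> X) : C :=
  if pselect (continuous f) is left fc then CFun (mem_set fc) else 0.

Lemma cfun_ofE (f : K -> X) : continuous f -> cfun_of f = f :> (K -> X).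
Proof. by move=> fc; rewrite /cfun_of; case: pselect. Qed.

Definition cut A f : C := cfun_of (fun x => if `[< A x >] then f x else 0).

Lemma cutE A f x : clopen A -> cut A f x = if `[< A x >] then f x else 0.
Proof.
move=> cA; rewrite /cut cfun_ofE//; apply: continuous_if_clopen => //.
  exact: cfun_continuous.
by move=> y; exact: cvg_cst.
Qed.

Lemma cutT A f x : clopen A -> A x -> cut A f x = f x.
Proof. by move=> cA Ax; rewrite cutE// asboolT. Qed.

Lemma cutF A f x : clopen A -> ~ A x -> cut A f x = 0.
Proof. by move=> cA Ax; rewrite cutE// asboolF. Qed.

Lemma cfunP f g : f =1 g -> f = g.
Proof. by move=> fg; apply: val_inj; apply/funext. Qed.

Lemma cfun_normP f M : 0 <= M -> `|f| <= M <-> forall x, `|f x| <= M.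
Proof. by move=> M0; rewrite cfun_normE; apply: sup_norm_leP => //; exact: cfun_bounded. Qed.

Lemma cfun_norm_ub f x : `|f x| <= `|f|.
Proof. by apply: sup_norm_ub; exact: cfun_bounded. Qed.

Lemma cut_norm A f : clopen A -> `|cut A f| <= `|f|.
Proof.
move=> cA; apply/cfun_normP => // x; have [Ax|nAx] := pselect (A x).
  by rewrite cutT// cfun_norm_ub.
by rewrite cutF// normr0.
Qed.

Lemma cutD A f : clopen A -> cut A f + cut (~` A) f = f.
Proof.
move=> cA; apply: cfunP => x; have cA' := clopenC A cA.
have [Ax|nAx] := pselect (A x).
  by rewrite [LHS](_ : _ = cut A f x + cut (~` A) f x)// cutT// cutF// addr0.
by rewrite [LHS](_ : _ = cut A f x + cut (~` A) f x)// cutF// cutT// add0r.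
Qed.

Lemma cutU A B f : clopen A -> clopen B -> A `&` B = set0 ->
  cut (A `|` B) f = cut A f + cut B f.
Proof.
move=> cA cB AB; apply: cfunP => x; have cAB := clopenU cA cB.
rewrite [RHS](_ : _ = cut A f x + cut B f x)//.
have [Ax|nAx] := pselect (A x).
  rewrite cutT; [|exact: cAB|by left].
  rewrite cutT// cutF ?addr0// => Bx.
  by have : (A `&` B) x by []; rewrite AB.
rewrite [cut A f x]cutF// add0r.
have [Bx|nBx] := pselect (B x).
  rewrite cutT; [|exact: cAB|by right].
  by rewrite cutT.
rewrite cutF; [|exact: cAB|by case].
by rewrite cutF.
Qed.

Lemma cut_set0 f : cut set0 f = 0.
Proof. by apply: cfunP => x; rewrite cutF//; exact: clopen0. Qed.

Lemma cut_disjoint_norm A f g M : clopen A -> `|f| <= M -> `|g| <= M ->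
  `|cut A f + cut (~` A) g| <= M.
Proof.
move=> cA fM gM; have M0 : 0 <= M by exact: le_trans fM.
have cA' := clopenC A cA.
apply/cfun_normP => // x.
rewrite (_ : (_ + _ : C) x = cut A f x + cut (~` A) g x)//.
have [Ax|nAx] := pselect (A x).
  by rewrite cutT// cutF// addr0 (le_trans (cfun_norm_ub _ _)).
by rewrite cutF// cutT// add0r (le_trans (cfun_norm_ub _ _)).
Qed.

End cfun_cut.

(** * The product of the Stone-Cech compactification with [1, omega] *)

Section retraction.
Local Notation L := (stone_cech nat * ord_itv1 nat)%type.
Implicit Types (l : L) (D : set (nat * nat)).

(** The points of [S] are dense in the clopen set of the ultrafilters containing [S]. *)
Lemma stone_cech_closed (J : Type) (Y : topologicalType) (h : stone_cech J -> Y)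
    (F : set Y) (S : set J) (u : stone_cech J) :
  continuous h -> closed F -> (forall k, S k -> F (h (stone_cech_in k))) ->
  u S -> F (h u).
Proof.
move=> hc cF SF uS; apply: cF => B /hc /stone_cech_nbhsP[S' uS' S'B].
have uU := stone_cech_ultra u.
have [k [Sk S'k]] := @filter_ex _ u _ _ (@filterI _ u _ _ _ uS uS').
exists (h (stone_cech_in k)); split; first exact: SF.
by apply: S'B; exact/principal_filterP.
Qed.

(** The index [0] of the top matches the junk value of [itv_point]. *)
Definition itv_index (q : ord_itv1 nat) : nat :=
  if q is ItvBelow n _ then n else 0%N.

Lemma itv_indexK : cancel itv_index (@itv_point _ nat).
Proof.
case=> [n n0|]; first by rewrite (itv_pointE n0).
by rewrite /itv_index /itv_point; case: eqP => // h; have := h.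
Qed.

Definition itv_retract (p : nat) (q : ord_itv1 nat) : ord_itv1 nat :=
  if `[< itv_above p q >] then ItvTop else q.

(** The levels above [p] form an open set, and each finite level is isolated. *)
Lemma itv_retract_near p q : \forall q' \near q, itv_retract p q' = itv_retract p q.
Proof.
rewrite /itv_retract; have [pq|npq] := asboolP (itv_above p q).
  have : \forall q' \near q, itv_above p q'.
    by apply: open_nbhs_nbhs; split=> //; exact: (clopen_itv_above p).1.
  by apply: filterS => q' pq'; rewrite asboolT.
suff : \forall q' \near q, q' = q by apply: filterS => q' ->; rewrite asboolF.
case: q npq => [n n0|]; last by move=> h; exfalso; exact: h.
move=> _; have n0' : (0 < n)%N by rewrite lt0n.
have : \forall q' \near ItvBelow n0, (itv_above n.-1 `&` ~` itv_above n) q'.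
  apply: open_nbhs_nbhs; split; last first.
    split=> /=; last by rewrite ltxx.
    by have : (n.-1 < n)%N by rewrite prednK.
  apply: openI; first exact: (clopen_itv_above _).1.
  exact: (clopenC set0 (clopen_itv_above _)).1.
apply: filterS => -[k k0|] [/= nk kn]; last by exfalso; exact: kn.
have {nk} : (n.-1 < k)%N by [].
have {kn} : ~ (n < k)%N by []; move=> kn nk.
have kE : k = n by lia.
rewrite -{}kE in n0 n0' nk kn *; congr ItvBelow; exact: bool_irrelevance.
Qed.

Definition retract p l : L := (l.1, itv_retract p l.2).

Lemma retract_near p l (S : set nat) : l.1 S ->
  nbhs l [set l' : L | l'.1 S /\ itv_retract p l'.2 = itv_retract p l.2].
Proof.
move=> lS; exists (stone_cech_basic S, [set q | itv_retract p q = itv_retract p l.2]).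
  split; last exact: itv_retract_near.
  by apply/stone_cech_nbhsP; exists S.
by move=> l' [].
Qed.

Lemma retract_continuous p : continuous (retract p).
Proof.
move=> l U [[U1 U2] /= [/stone_cech_nbhsP[S lS SU] U2l] U12].
apply: filterS (retract_near p lS) => l' [l'S l'2]; apply: U12; split=> /=.
  exact: SU.
by rewrite l'2; exact: nbhs_singleton.
Qed.

(* The clopen set of points of [L] whose image under [retract p] lies in the
   closure of [D], where [(k, q)] stands for the isolated point [k] of the
   [q]-th copy of the Stone-Cech compactification, the index [0] being that of
   the copy at infinity. *)
Definition hat p D : set L :=
  [set l : L | l.1 [set k | D (k, itv_index (itv_retract p l.2))]].

Lemma hatC p D : ~` hat p D = hat p (~` D).
Proof.
apply/seteqP; split=> l; have uU := stone_cech_ultra l.1.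
  by move=> nD; have [//|] := @in_ultra_setVsetC _ _
    [set k | D (k, itv_index (itv_retract p l.2))] uU.
by move=> nD Dl; have [k []] := @filter_ex _ l.1 _ _ (@filterI _ l.1 _ _ _ nD Dl).
Qed.

Lemma hat_open p D : open (hat p D).
Proof.
rewrite openE => l lD; rewrite /interior.
by apply: filterS (retract_near p lD) => l' [+ l'2]; rewrite /hat /= l'2.
Qed.

Lemma clopen_hat p D : clopen (hat p D).
Proof.
by split; [exact: hat_open|rewrite -openC hatC; exact: hat_open].
Qed.

Lemma hat0 p : hat p set0 = set0.
Proof.
rewrite -subset0 => l l0; have uU := stone_cech_ultra l.1.
by have [k] := @filter_ex _ l.1 _ _ l0.
Qed.

Lemma hatI p D E : hat p (D `&` E) = hat p D `&` hat p E.
Proof.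
apply/seteqP; split=> l; have uU := stone_cech_ultra l.1.
  by move=> DE; split; apply: (@filterS _ l.1 _ _ _ _ DE) => k [].
by move=> [lD lE]; exact: (@filterI _ l.1 _ _ _ lD lE).
Qed.

Lemma hatU p D E : hat p (D `|` E) = hat p D `|` hat p E.
Proof. by rewrite -[LHS]setCK hatC setCU hatI -!hatC setCI !setCK. Qed.

Definition upper p : set L := [set l | itv_above p l.2].

Lemma clopen_upper p : clopen (upper p).
Proof.
have [oA cA] := clopen_itv_above (p : nat).
split.
  by apply: open_comp oA => l _; exact: cvg_snd.
by apply: closed_comp cA => l _; exact: cvg_snd.
Qed.

Lemma upperS p q : (p <= q)%N -> upper q `<=` upper p.
Proof.
move=> pq [u [n n0|//]]; rewrite /upper /=; exact: Order.POrderTheory.le_lt_trans.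
Qed.

End retraction.

Section functionals.
Context {R : realType} (X : normedModType R).
Local Notation L := (stone_cech nat * ord_itv1 nat)%type.
Local Notation V := (cfun L X).
Implicit Types (u v w : V) (m : {linear V -> R^o}).

Lemma cut_hat_additive m p u :
  finitely_additive (fun D : set (nat * nat) => m (cut (hat p D) u) : R).
Proof.
move=> D E DE; rewrite hatU cutU ?linearD//; try exact: clopen_hat.
by rewrite -hatI DE hat0.
Qed.

(** By compactness, if the norm of [u] reached [e] above every level [p], it would do so at a point
    of level omega, where [u] vanishes. *)
Lemma tail_small u e : 0 < e -> (forall x, u (x, ItvTop) = 0) ->
  exists p, forall l, upper p l -> `|u l| <= e.
Proof.
move=> e0 uT; apply: contrapT => /forallNP np.
pose F p := upper p `&` [set l | e <= `|u l|].
have [||||l lF] := @compact_decreasing_point L F.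
- exact: compactT.
- move=> p; apply: closedI; first exact: (clopen_upper p).2.
  have cn : continuous (fun l => `|u l|).
    by move=> l; apply: cvg_norm; exact: cfun_continuous.
  rewrite (_ : [set l | _] = (fun l => `|u l|) @^-1` [set r | e <= r])//.
  by apply: closed_comp => [l _|]; [exact: cn|exact: closed_ge].
- by move=> p q pq l [lq ul]; split=> //; exact: upperS pq _ lq.
- move=> p; have /existsNP[l /not_implyP[lp /negP]] := np p.
  by rewrite -ltNge => ul; exists l; split=> //; exact: ltW.
case: l lF => x [n n0|] lF.
  by have [] := lF n; rewrite /upper /= ltxx.
by have [_ /=] := lF 0%N; rewrite uT normr0 leNgt e0.
Qed.

(* [w] almost attains the norm of [m] on the functions supported by finitely
   many copies; a function [u] supported by further copies could be added to it,
   so [m u] must be small. *)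
Lemma quiet_bound m (CS a e M h : R) p w u :
  (forall v, `|m v| <= CS * `|v|) -> 0 < M -> 0 < h ->
  `|w| <= 1 -> (forall l, upper p l -> w l = 0) -> a < m w ->
  (forall q v, `|v| <= 1 -> (forall l, upper q l -> v l = 0) -> m v <= a + e) ->
  `|u| <= M -> (forall l, ~ upper p l -> u l = 0) ->
  (forall x, u (x, ItvTop) = 0) -> m u <= M * e + h.
Proof.
move=> mCS M0 h0 w1 wp aw mq uM up uT.
have h' : 0 < h / (`|CS| + 1) by rewrite divr_gt0// ltr_wpDl.
have [q qu] := tail_small h' uT.
have cq := clopen_upper q; have cq' := clopenC (upper q) cq.
have mu2 : m (cut (upper q) u) <= h.
  apply: le_trans (ler_norm _) _; apply: le_trans (mCS _) _.
  have : `|cut (upper q) u| <= h / (`|CS| + 1).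
    apply/cfun_normP => [|l]; first exact: ltW.
    have [ql|nql] := pselect (upper q l); first by rewrite cutT// qu.
    by rewrite cutF// normr0 ltW.
  rewrite ler_pdivlMr ?ltr_wpDl// => H.
  apply: le_trans (ler_wpM2r (normr_ge0 _) (ler_norm CS)) _.
  by apply: le_trans H; rewrite mulrDr mulr1 mulrC lerDl.
have mu1 : m (cut (~` upper q) u) <= M * e.
  (* The summands have disjoint supports, so [z] still has norm at most [1]. *)
  pose z : V := w + M^-1 *: cut (~` upper q) u.
  have zE l : z l = w l + M^-1 *: cut (~` upper q) u l by [].
  have : m z <= a + e.
    apply: (mq (maxn p q)).
      apply/cfun_normP => // l; rewrite zE.
      have [pl|npl] := pselect (upper p l).
        rewrite wp// add0r normrZ gtr0_norm ?invr_gt0// ler_pdivrMl// mulr1.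
        apply: le_trans uM; apply: le_trans (cut_norm u cq'); exact: cfun_norm_ub.
      have -> : cut (~` upper q) u l = 0 by rewrite cutE// up// if_same.
      by rewrite scaler0 addr0 (le_trans (cfun_norm_ub _ _)).
    move=> l lpq; rewrite zE wp; last by apply: upperS lpq; exact: leq_maxl.
    rewrite cutF ?scaler0 ?addr0//; apply.
    by apply: upperS lpq; exact: leq_maxr.
  rewrite /z linearD linearZ /= => H.
  have : M^-1 * m (cut (~` upper q) u) <= e.
    by move: H aw; rewrite /GRing.scale /=; lra.
  by rewrite ler_pdivrMl.
rewrite -[u](cutD u cq) linearD /= addrC; exact: lerD.
Qed.

End functionals.

(** * The descent in an abstract tree *)

Section game.
Context {R : realType} (X : normedModType R).
Local Notation L := (stone_cech nat * ord_itv1 nat)%type.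
Local Notation V := (cfun L X).
Implicit Types (u v w : V).

(** The set functions split into their limit, exhaustive because bounded, and a sequence tending to
    [0] on every set, exhaustive by Phillips' lemma. The Egorov argument applies to both. *)
Lemma cut_hat_cvg0 p (m : nat -> {linear V -> R^o}) (mlim : {linear V -> R^o})
    (CS : R) u (A : nat -> set (nat * nat)) :
  (forall i v, `|m i v| <= CS * `|v|) -> (forall v, `|mlim v| <= CS * `|v|) ->
  (forall v, m i v @[i --> \oo] --> mlim v) ->
  (forall l, \forall i \near \oo, ~ hat p (A i) l) ->
  m i (cut (hat p (A i)) u) @[i --> \oo] --> (0 : R^o).
Proof.
move=> mC mlimC mcvg Afin.
have CS0 : 0 <= CS * `|u| by exact: le_trans (mlimC u).
have cutC (f : {linear V -> R^o}) D : (forall v, `|f v| <= CS * `|v|) ->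
    `|f (cut (hat p D) u)| <= CS * `|u|.
  move=> fC; apply: le_trans (fC _) _.
  have [c0|c0] := leP 0 CS.
    by apply: ler_wpM2l => //; apply: cut_norm; exact: clopen_hat.
  have u0 : `|u| = 0.
    apply/eqP; rewrite eq_le normr_ge0 andbT -(ler_nM2l c0) mulr0//.
  suff -> : `|cut (hat p D) u| = 0 by rewrite mulr0.
  apply/eqP; rewrite eq_le normr_ge0 andbT -u0.
  by apply: cut_norm; exact: clopen_hat.
pose nu (D : set (nat * nat)) : R := mlim (cut (hat p D) u).
pose mu i (D : set (nat * nat)) : R := m i (cut (hat p D) u) - nu D.
have egorov (k : nat -> set (nat * nat) -> R) := @exhaustive_egorov R L _ (hat p) k A
  (@compactT L) (fun D => (clopen_hat p D).2) (hat0 p) (hatU p).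
have nuA : nu (A i) @[i --> \oo] --> 0.
  apply: (egorov (fun=> nu)) => // [_|_ D D0|].
  - exact: cut_hat_additive.
  - by rewrite /nu D0 cut_set0 linear0.
  - apply: (@exhaustive_const _ _ nu (CS * `|u|)); first exact: cut_hat_additive.
    by move=> D; exact: cutC.
have mua i : finitely_additive (mu i).
  move=> D E DE; rewrite /mu /nu (cut_hat_additive mlim p u DE).
  by rewrite (cut_hat_additive (m i) p u DE) opprD addrACA.
have muA : mu i (A i) @[i --> \oo] --> 0.
  apply: (egorov mu) => // [i D D0|].
    by rewrite /mu /nu D0 cut_set0 !linear0 addr0.
  have := @exhaustive_cvg0 R _ mu (CS * `|u| + CS * `|u|) mua.
  apply=> [i D|D].
    by apply: le_trans (ler_normB _ _) _; apply: lerD; apply: cutC.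
  have -> : (0 : R) = nu D - nu D by rewrite subrr.
  by apply: cvgB (cvg_cst _); exact: mcvg.
have -> : (0 : R^o) = (0 : R) + 0 by rewrite addr0.
apply: cvg_trans (cvgD muA nuA).
by apply: near_eq_cvg; apply: filterE => i; rewrite /mu /= subrK.
Qed.

Variables (Node : Type) (depth : Node -> nat) (child : Node -> nat -> Node).
Variables (m : Node -> {linear V -> R^o}) (v : Node -> V) (CS CT : R).
Hypotheses
  (deep : forall N, exists s, (N <= depth s)%N)
  (depth_child : forall s c, depth (child s c) = (depth s).-1)
  (mC : forall s w, `|m s w| <= CS * `|w|)
  (vC : forall s, `|v s| <= CT)
  (mv : forall s, m s (v s) = 1)
  (m_child : forall s w, (0 < depth s)%N ->
    m (child s c) w @[c --> \oo] --> m s w)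
  (v_child : forall s l, (0 < depth s)%N ->
    v (child s c) l @[c --> \oo] --> (0 : X)).

Let CS_CT : [/\ 0 < CS, 0 < CT & 1 <= CS * CT].
Proof.
have [s _] := deep 0.
have sC : 1 <= CS * `|v s| by rewrite -(mv s) (le_trans (ler_norm _)).
have CS0 : 0 < CS.
  by rewrite ltNge; apply/negP => CS0; have := normr_ge0 (v s); nra.
have CSCT : 1 <= CS * CT by apply: le_trans sC _; rewrite ler_pM2l.
by split=> //; rewrite -(pmulr_rgt0 _ CS0) (lt_le_trans _ CSCT).
Qed.

(** Functions of norm at most [2 * CT] then contribute [2 * CT * e = 1 / 8] in [quiet_bound]. *)
Let e := (16 * CT)^-1.
Let e0 : 0 < e. Proof. by have [_ ? _] := CS_CT; rewrite invr_gt0 mulr_gt0. Qed.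

Let norming (t : R) s p w :=
  [/\ `|w| <= 1, forall l, upper p l -> w l = 0 & t < m s w].

(* The largest value asymptotically attained, deep in the tree, on functions
   supported by finitely many copies, up to [e]. *)
Let quiet_level : exists j N : nat,
  (forall N', exists s, (N' <= depth s)%N /\ exists p w, norming ((j%:R - 1) * e) s p w) /\
  (forall s p w, (N <= depth s)%N -> `|w| <= 1 -> (forall l, upper p l -> w l = 0) ->
    m s w <= (j%:R - 1) * e + e).
Proof.
pose G (j : nat) := forall N, exists s, (N <= depth s)%N /\
  exists p w, norming ((j%:R - 1) * e) s p w.
apply: contrapT => nex.
(* The shift in [j%:R - 1] lets the zero function start the induction; the levels cannot grow
   forever, being below [CS]. *)
have Gall j : G j.
  elim: j => [N|j IH N].
    have [s Ns] := deep N; exists s; split=> //; exists 0%N, 0.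
    by split=> //; rewrite ?normr0// linear0 sub0r mulN1r oppr_lt0.
  apply: contrapT => nG; apply: nex; exists j, N; split=> // s p w Ns w1 wp.
  rewrite leNgt; apply/negP => sw; apply: nG; exists s; split=> //; exists p, w.
  by split=> //; move: sw; rewrite -natr1; lra.
pose j := (Num.bound `|CS / e|).+1.
have [s [_ [p [w [w1 _]]]]] := Gall j 0%N; apply/negP; rewrite -leNgt.
have [CS0 _ _] := CS_CT.
apply: le_trans (ler_norm _) _; apply: le_trans (mC _ _) _.
apply: (@le_trans _ _ CS); first by rewrite ger_pMr.
rewrite /j -natr1 addrK -ler_pdivrMr//.
by rewrite (le_trans (ler_norm _))// ltW//; exact: archi_boundP.
Qed.

(** A function [w] fixed at the start keeps its value above [a] at every node visited, while each of
    the [n] steps raises [m t u] by at least [1 / 2] with the norm of [u] at most [CT]. In the end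
    [m t u] exceeds [CS * CT]. *)
Lemma no_tree : False.
Proof.
have [CS0 CT0 CSCT] := CS_CT.
have [j [N [Gj quiet]]] := quiet_level.
pose n := (Num.bound `|2 * (CS * CT)|).+1.
have nC : CS * CT < n%:R / 2.
  rewrite ltr_pdivlMr// mulrC (le_lt_trans (ler_norm _))//.
  by apply: lt_le_trans (archi_boundP _) _ => //; rewrite ler_nat.
have [s0 [ds0 [p [w [w1 wp s0w]]]]] := Gj (N + n)%N.
pose a := (j%:R - 1) * e.
suff /(_ n (leqnn n))[t [u [_ uC _ tu]]] : forall k, (k <= n)%N -> exists t u,
    [/\ (N + (n - k) <= depth t)%N, `|u| <= CT, a < m t w & k%:R / 2 <= m t u].
  have := le_trans (ler_norm _) (mC t u); have := ler_wpM2l (ltW CS0) uC.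
  by move: nC tu; lra.
elim=> [_|k IH kn].
  exists s0, 0; split=> //.
    by rewrite normr0 ltW.
  by rewrite linear0 mul0r.
have [t [u [dt uC tw tu]]] := IH (ltnW kn).
have dt0 : (0 < depth t)%N by apply: leq_trans dt; rewrite addn_gt0 subn_gt0 kn orbT.
pose g i := v (child t i).
(* The levels above [p] receive the values of [g i] at level omega, so [g i - Eg i] vanishes at
   omega and on the levels up to [p], as [quiet_bound] requires. *)
pose Eg i : V := cfun_of (g i \o retract p).
have EgE i l : Eg i l = g i (retract p l).
  rewrite /Eg cfun_ofE// => x.
  exact: (continuous_comp (@retract_continuous p x) (@cfun_continuous _ _ _ (g i) _)).
have EgC i : `|Eg i| <= CT.
  apply/cfun_normP => [|l]; first exact: ltW.
  by rewrite EgE; apply: le_trans (vC (child t i)); exact: cfun_norm_ub.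
(* The part of [Eg i] of norm at most [r] contributes at most [CS * r = 1 / 8]. *)
pose r := (8 * CS)^-1; have r0 : 0 < r by rewrite invr_gt0 mulr_gt0.
pose gn i (kq : nat * nat) : R := `|g i (stone_cech_in kq.1, itv_point kq.2)|.
pose A i := [set kq | r <= gn i kq].
have gnE i (F : set R) l : closed F ->
    hat p [set kq | F (gn i kq)] l -> F `|Eg i l|.
  move=> cF lF; rewrite EgE; set q := itv_retract p l.2.
  have gc : continuous (fun x : stone_cech nat => `|g i (x, q)|).
    have qc : continuous (fun x : stone_cech nat => (x, q)).
      move=> x U [[B B'] [xB qB'] BU]; apply: (@filterS _ _ (nbhs_filter x)) xB.
      by move=> y By; apply: BU; split=> //; exact: nbhs_singleton qB'.
    move=> x; have gqc := continuous_comp (qc x) (@cfun_continuous _ _ _ (g i) _).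
    exact: continuous_comp gqc (@norm_continuous _ _ _).
  apply: (stone_cech_closed gc cF _ lF).
  by move=> k' /=; rewrite /gn /= itv_indexK.
have AE i l : hat p (A i) l -> r <= `|Eg i l|.
  by move=> lA; apply: (gnE i [set x | r <= x]) => //; exact: closed_ge.
have nAE i l : ~ hat p (A i) l -> `|Eg i l| <= r.
  move=> nlA; apply: (gnE i [set x | x <= r]); first exact: closed_le.
  have : (~` hat p (A i)) l by [].
  rewrite hatC; have uU := stone_cech_ultra l.1.
  apply: (@filterS _ l.1); move=> k' /= /negP; rewrite -ltNge; exact: ltW.
have Afin l : \forall i \near \oo, ~ hat p (A i) l.
  have /cvgr0_norm_lt /(_ _ r0) := v_child (retract p l) dt0.
  by apply: filterS => i gr /AE; rewrite EgE leNgt gr.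
(* Of the value [m s (g i) = 1], passing to [Eg i] costs at most [1 / 4] and cutting to
   [hat p (A i)] at most [1 / 8]. *)
have Eg_mass i : (N <= depth (child t i))%N -> a < m (child t i) w ->
    5 / 8 <= m (child t i) (cut (hat p (A i)) (Eg i)).
  move=> Ni iw; set s := child t i in Ni iw *.
  have gEg : m s (g i - Eg i) <= 1 / 4.
    have h0 : 0 < 1 / 8 :> R by [].
    have M0 : 0 < 2 * CT by rewrite mulr_gt0.
    apply: le_trans (@quiet_bound _ _ (m s) CS a e (2 * CT) (1 / 8) p w _
      (mC s) M0 h0 w1 wp iw _ _ _ _) _.
    - by move=> q v' v1 vq; exact: quiet Ni v1 vq.
    - rewrite mulr_natl mulr2n; apply: le_trans (ler_normB _ _) _.
      by apply: lerD; [exact: vC|exact: EgC].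
    - move=> l npl; rewrite (_ : _ l = g i l - Eg i l)// EgE /retract /itv_retract.
      by rewrite asboolF// -surjective_pairing subrr.
    - move=> x; rewrite (_ : _ (x, _) = g i (x, ItvTop) - Eg i (x, ItvTop))//.
      by rewrite EgE /retract /itv_retract/= if_same subrr.
    have -> : 2 * CT * e = 1 / 8 by rewrite /e; field; rewrite gt_eqF.
    by lra.
  have cutEg : m s (cut (~` hat p (A i)) (Eg i)) <= 1 / 8.
    apply: le_trans (ler_norm _) _; apply: le_trans (mC _ _) _.
    have -> : 1 / 8 = CS * r :> R by rewrite /r; field; rewrite gt_eqF.
    apply: ler_wpM2l; first exact: ltW.
    have cA := clopenC set0 (clopen_hat p (A i)).
    apply/cfun_normP => [|l]; first exact: ltW.
    have [lA|nlA] := pselect ((~` hat p (A i)) l); first by rewrite cutT// nAE.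
    by rewrite cutF// normr0 ltW.
  have : m s (g i) = 1 by exact: mv.
  have : m s (Eg i) = m s (cut (hat p (A i)) (Eg i)) + m s (cut (~` hat p (A i)) (Eg i)).
    by rewrite -linearD cutD//; exact: clopen_hat.
  move: gEg cutEg; rewrite linearB /=.
  by move: (m s (g i)) (m s (Eg i)) (m s _) (m s _) => x y z z'; rewrite /=; lra.
have h1 : 0 < 1 / 16 :> R by [].
have near1 : \forall i \near \oo, a < m (child t i) w.
  exact: (cvgr_gt (m t w : R) (@m_child t w dt0)).
have near2 : \forall i \near \oo, m t u - 1 / 16 < m (child t i) u.
  by apply: (cvgr_gt (m t u : R) (@m_child t u dt0)); rewrite ltrBlDr ltrDl.
have near3 : \forall i \near \oo, m (child t i) (cut (hat p (A i)) u) < 1 / 16.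
  apply: (cvgr_lt (0 : R) (@cut_hat_cvg0 p (fun i => m (child t i)) (m t) CS
    u A _ _ _ Afin) _ h1).
  - by move=> i; exact: mC.
  - exact: mC.
  - by move=> w'; exact: m_child.
have [i [[iw iu] iA]] := filter_ex (filterI (filterI near1 near2) near3).
have Ni : (N + (n - k.+1) <= depth (child t i))%N.
  by rewrite depth_child -ltnS (prednK dt0) -addnS subnSK.
have Ni' : (N <= depth (child t i))%N by apply: leq_trans Ni; exact: leq_addr.
(* Overwriting [u] by [Eg i] where the latter is not small gains at least
   [5 / 8 - 1 / 16 - 1 / 16 = 1 / 2]. *)
exists (child t i), (cut (hat p (A i)) (Eg i) + cut (~` hat p (A i)) u).
split; [exact: Ni|exact: cut_disjoint_norm (clopen_hat p (A i)) (EgC i) uC|exact: iw|].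
have := Eg_mass i Ni' iw; move: iA iu tu.
have : m (child t i) u = m (child t i) (cut (hat p (A i)) u) +
    m (child t i) (cut (~` hat p (A i)) u).
  by rewrite -linearD cutD//; exact: clopen_hat.
rewrite linearD /= -[k.+1%:R]natr1.
move: (m _ u) (m _ u) (m _ (cut _ _)) (m _ (cut _ _)) (m _ (cut _ _)) => x y z z' y'.
rewrite /=; lra.
Qed.

End game.

(** * The tree of intervals of [1, omega^omega] *)

Lemma continuous_linear_norm_bound (R : realType) (V W : normedModType R)
    (f : {linear V -> W}) :
  {for 0, continuous f} -> exists C, forall v, `|f v| <= C * `|v|.
Proof. by move=> /continuous_linear_bounded /linear_boundedP /filter_ex. Qed.

Section ordinal_tree.
Context {R : realType}.
Local Notation node := (ordpow nat nat * nat)%type.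
Local Notation W := (cfun (ord_itv1 (ordpow nat nat)) R^o).
Implicit Types (s : node) (b : ordpow nat nat) (c k : nat).

Definition node_inf s := digit s.1 s.2 (s.1 s.2).
Definition node_sup s := digit s.1 s.2 (s.1 s.2).+1.

(* Writing [s = (b, k)], the interval of [s] is [(b, b + omega ^ k]] for [b] cut
   below the exponent [k], and its children split it into the intervals
   [(b + omega ^ k.-1 * c, b + omega ^ k.-1 * c.+1]] and its supremum. *)
Definition node_child s c : node := (digit s.1 s.2.-1 c, s.2.-1).

Definition node_itv s : set (ord_itv1 (ordpow nat nat)) :=
  itv_above (node_inf s) `\` itv_above (node_sup s).

Definition node_fun s : W := cut (node_itv s) (cfun_of (fun=> 1 : R^o)).

Lemma clopen_node_itv s : clopen (node_itv s).
Proof.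
apply: clopenI; first exact: clopen_itv_above.
by apply: clopenC; [exact: set0|exact: clopen_itv_above].
Qed.

Lemma digit_digit b k c c' : digit (digit b k c) k c' = digit b k c'.
Proof.
by apply: ordpowP => x; rewrite !digitE; case: ltngtP.
Qed.

Lemma node_inf_child s c : node_inf (node_child s c) = digit s.1 s.2.-1 c.
Proof. by rewrite /node_inf /= digit_at digit_digit. Qed.

Lemma node_sup_child s c : node_sup (node_child s c) = digit s.1 s.2.-1 c.+1.
Proof. by rewrite /node_sup /= digit_at digit_digit. Qed.

Lemma node_sup_cvg s : (0 < s.2)%N ->
  itv_point (node_sup (node_child s c)) @[c --> \oo] --> itv_point (node_sup s).
Proof.
case: s => b [//|k] _; apply: itv_point_cvg => [|c|c|z].
- exact: digit_neq0.
- exact: digit_neq0.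
- by rewrite node_sup_child; apply: ltW; exact: digit_ltS.
- by move=> /digit_sup; apply: filterS => c; rewrite node_sup_child.
Qed.

Lemma node_fun1 s q : node_itv s q -> node_fun s q = 1.
Proof.
move=> sq; rewrite cutT//; last exact: clopen_node_itv.
by rewrite cfun_ofE//; exact: cst_continuous.
Qed.

Lemma node_fun0 s q : ~ node_itv s q -> node_fun s q = 0.
Proof. by move=> sq; rewrite /node_fun cutF//; exact: clopen_node_itv. Qed.

Lemma node_fun_sup s : node_fun s (itv_point (node_sup s)) = 1.
Proof.
have s0 : node_sup s != \bot%O by exact: digit_neq0.
apply: node_fun1; split; rewrite itv_above_point// ?ltxx//.
exact: digit_lt.
Qed.

Lemma node_fun_norm s : `|node_fun s| <= 1.
Proof.
apply/cfun_normP => // q; have [sq|nsq] := pselect (node_itv s q).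
  by rewrite node_fun1// normr1.
by rewrite node_fun0// normr0.
Qed.

Lemma itv_aboveS d (A : wellOrderType d) (x y : A) : (x <= y)%O ->
  itv_above y `<=` itv_above x.
Proof. by move=> xy [z z0|//]; exact: Order.POrderTheory.le_lt_trans. Qed.

(** The intervals of the children are disjoint, so at each point at most one term is nonzero. *)
Lemma box_node_fun s a n : box a ->
  `|\sum_(0 <= c < n) a c *: node_fun (node_child s c)| <= (1 : R).
Proof.
move=> a1; apply/cfun_normP => // q.
pose F c : R := a c * node_fun (node_child s c) q.
have -> : (\sum_(0 <= c < n) a c *: node_fun (node_child s c) : W) q
    = \sum_(0 <= c < n) F c.
  elim: n => [|n IH]; first by rewrite !big_geq.
  by rewrite !big_nat_recr//= -IH.
elim: n => [|n IH]; first by rewrite big_geq// normr0.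
rewrite big_nat_recr//=; have [qn|nqn] := pselect (node_itv (node_child s n) q).
  rewrite big_nat_cond big1 ?add0r => [|c /andP[/andP[_ cn] _]].
    by rewrite /F node_fun1// mulr1.
  rewrite /F node_fun0 ?mulr0// => -[_]; apply; move: qn => -[+ _].
  rewrite node_sup_child node_inf_child; apply: itv_aboveS.
  move: cn; rewrite leq_eqVlt => /predU1P[->//|cn].
  by apply: ltW; exact: digit_lt.
by rewrite /F (node_fun0 nqn) mulr0 addr0.
Qed.

End ordinal_tree.

Theorem theorem3p2 (R : realType) (X : completeNormedModType R) :
  contains_complemented_copy
    (cfun (stone_cech nat * ord_itv1 nat)%type X)
    (cfun (ord_itv1 (ordpow nat nat)) R^o) ->
  contains_copy X (c0 R).
Proof.
set V := cfun _ X; set W := cfun _ _.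
move=> [S [[_ [P [Pc PP PS]]] [T [T' [Tc TS TT' T'c]]]]].
apply: contrapT => noc0.
have TP u : exists x, T x = P u.
  have : S (P u) by rewrite -PS; exists u.
  by rewrite -TS => -[x _ <-]; exists x.
(* A left inverse of [T], linear because [P] maps into the range of [T], where [T'] inverts a linear
   map. *)
pose Q u : W := T' (P u).
have Qlin : linear Q.
  move=> a u w; rewrite /Q linearP; have [x <-] := TP u; have [y <-] := TP w.
  by rewrite -linearP !TT'.
pose QL : {linear V -> W} := HB.pack Q (GRing.isLinear.Build R V W *:%R Q Qlin).
have QT f : Q (T f) = f.
  have : S (T f) by rewrite -TS; exists f.
  by rewrite -PS /Q => -[u _ uf]; rewrite -uf PP uf TT'.
have [CS QC] : exists C, forall u, `|QL u| <= C * `|u|.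
  apply: continuous_linear_norm_bound => U.
  have S0 : S 0 by rewrite -TS; exists 0 => //; exact: linear0.
  rewrite /= /Q linear0 => /((subspace_continuousP _ _).1 T'c 0 S0) T'U.
  have : nbhs (P 0) [set y | S y -> U (T' y)] by rewrite linear0.
  move=> /Pc; apply: (@filterS _ _ (nbhs_filter (0 : V))) => u; apply.
  by rewrite -PS; exists u.
have [C TC] := continuous_linear_norm_bound (Tc 0).
pose m (s : ordpow nat nat * nat) (u : V) : R^o := Q u (itv_point (node_sup s)).
have mlin s : linear (m s).
  by move=> a u w; rewrite /m Qlin.
pose mL s : {linear V -> R^o} := HB.pack (m s)
  (GRing.isLinear.Build R V R^o *:%R (m s) (mlin s)).
pose v s : V := T (node_fun s).
apply: (@no_tree R X _ snd node_child mL v CS `|C|).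
- by move=> N; exists (\bot%O, N).
- by [].
- by move=> s u; apply: le_trans (QC u); exact: cfun_norm_ub.
- move=> s; apply: le_trans (TC _) _; apply: le_trans (ler_norm _) _.
  by rewrite normrM normr_id ler_piMr// node_fun_norm.
- by move=> s; rewrite /= /m QT node_fun_sup.
- move=> s u s0; exact: cvg_comp (node_sup_cvg s0) (@cfun_continuous _ _ _ (Q u) _).
(* Otherwise the values at [l] would be the terms of a weakly unconditionally Cauchy series in [X]
   that do not tend to [0], and [X] would contain c_0. *)
- move=> s l s0; apply: contrapT => /cvgr0Pnorm_lt /existsNP[d /not_implyP[d0 nd]].
  apply: noc0; apply: (@contains_c0 _ _ (fun c => v (node_child s c) l) `|C| d) => //.
    move=> n a a1.
    have -> : \sum_(0 <= i < n) a i *: v (node_child s i) l =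
        T (\sum_(0 <= i < n) a i *: node_fun (node_child s i)) l.
      elim: n => [|n IH]; first by rewrite !big_geq// linear0.
      by rewrite !big_nat_recr//= linearD linearZ /= IH.
    apply: le_trans (cfun_norm_ub _ _) _; apply: le_trans (TC _) _.
    apply: le_trans (ler_norm _) _.
    by rewrite normrM normr_id ler_piMr// box_node_fun.
  move=> N; apply: contrapT => /forall2NP h; apply: nd; exists N => // i /= Ni.
  by rewrite ltNge; apply/negP; have [] := h i.
Qed.
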